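(* Let $\Phi_1$ and $\Phi_2$ be two $\mathcal{C}^1$ convex growth functions with $\Phi_2\in\mathscr{U}$, and let $\alpha,\beta>-1$. Assume that $\Phi_1$ satisfies the $\nabla_2$-condition and that $\frac{\Phi_2}{\Phi_1}$ is nondecreasing. Then the Bergman–Orlicz space $A_\alpha^{\Phi_1}(\mathbb{C}_+)$ embeds continuously into the Bergman–Orlicz space $A_\beta^{\Phi_2}(\mathbb{C}_+)$ if and only if there exists a constant $C>0$ such that for any $t\in (0,\infty)$, $$\Phi_1^{-1}(t^{2+\alpha})\leq \Phi_2^{-1}(Ct^{2+\beta}).$$
   Context: $\mathbb{C}_+=\{x+iy: y>0\}$. A growth function is a continuous nondecreasing function from $[0,\infty)$ onto $[0,\infty)$; $\Phi^{-1}$ is its inverse. $\mathscr{U}^q$ ($q\ge1$) is the set of growth functions $\Phi$ with $\Phi(st)\le Ct^q\Phi(s)$ for $s>0,t\ge1$ and $t\mapsto\Phi(t)/t$ nondecreasing; $\mathscr{U}=\bigcup_{q\ge1}\mathscr{U}^q$. A convex $\Phi$ satisfies the $\nabla_2$-condition if both $\Phi$ and its complementary function $\Psi(s)=\sup_{t\ge0}\{ts-\Phi(t)\}$ satisfy the $\Delta_2$-condition ($F(2t)\le KF(t)$ for some $K>1$, all $t\ge0$). For $\gamma>-1$, $dV_\gamma(x+iy)=y^\gamma dxdy$, and $A^\Phi_\gamma(\mathbb{C}_+)$ is the space of holomorphic $f$ with $\int\Phi(|f|)dV_\gamma<\infty$, normed by $\|f\|^{lux}_{\Phi,\gamma}=\inf\{\lambda>0:\int_{\mathbb{C}_+}\Phi(|f|/\lambda)dV_\gamma\le1\}$.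 Continuous embedding means inclusion with $\|f\|^{lux}_{\Phi_2,\beta}\le C'\|f\|^{lux}_{\Phi_1,\alpha}$. *)

(* Defs.v *)
From HB Require Import structures.
From mathcomp Require Import all_boot all_order all_algebra.
From mathcomp Require Import all_classical all_reals all_analysis.
From mathcomp Require Import complex.
Import numFieldNormedType.Exports.
Import Order.TTheory GRing.Theory Num.Theory.

Set Implicit Arguments.
Unset Strict Implicit.
Unset Printing Implicit Defensive.

Local Open Scope classical_set_scope.
Local Open Scope ring_scope.

Section Defs.
Variable R : realType.

Definition growth_function (Phi : R -> R) : Prop :=
  {within `[0, +oo[, continuous Phi} /\
  (forall s t, 0 <= s -> s <= t -> Phi s <= Phi t) /\
  (forall t, 0 <= t -> 0 <= Phi t) /\
  (forall u, 0 <= u -> exists2 t, 0 <= t & Phi t = u).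

Definition convex_on_nonneg (Phi : R -> R) : Prop :=
  forall s t l, 0 <= s -> 0 <= t -> 0 <= l -> l <= 1 ->
    Phi (l * s + (1 - l) * t) <= l * Phi s + (1 - l) * Phi t.

(** C^1 on [0,oo): derivative exists on (0,oo) and extends to a continuous
    function on [0,oo) (equivalently, one-sided derivative at 0). *)
Definition C1_on_nonneg (Phi : R -> R) : Prop :=
  exists dPhi : R -> R,
    {within `[0, +oo[, continuous dPhi} /\
    forall t : R, 0 < t -> is_derive t (1 : R) Phi (dPhi t).

(** Inverse of a growth function: Phi^{-1}(s) = sup {t >= 0 | Phi t <= s};
    for s > 0 this is the unique t >= 0 with Phi t = s. *)
Definition ginv (Phi : R -> R) (s : R) : R :=
  sup [set t | 0 <= t /\ Phi t <= s].

Definition class_Uq (q : R) (Phi : R -> R) : Prop :=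
  (exists2 C : R, 0 < C &
     forall s t, 0 < s -> 1 <= t -> Phi (s * t) <= C * (t `^ q) * Phi s) /\
  (forall s t, 0 < s -> s <= t -> Phi s / s <= Phi t / t).

Definition class_U (Phi : R -> R) : Prop :=
  exists2 q : R, 1 <= q & class_Uq q Phi.

Definition complementary (Phi : R -> R) (s : R) : \bar R :=
  ereal_sup [set ((t * s - Phi t)%:E) | t in [set t : R | 0 <= t]].

Definition Delta2 (F : R -> R) : Prop :=
  exists2 K : R, 1 < K & forall t, 0 <= t -> F (2 * t) <= K * F t.

Definition Delta2E (F : R -> \bar R) : Prop :=
  exists2 K : R, 1 < K & forall t : R, 0 <= t -> (F (2 * t)%R <= K%:E * F t)%E.

Definition nabla2 (Phi : R -> R) : Prop :=
  Delta2 Phi /\ Delta2E (complementary Phi).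

Definition upper_half_plane : set R[i] := [set z | 0 < complex.Im z].

Definition upper_half_plane_R2 : set (R * R) := [set p | 0 < p.2].

Definition holomorphic_on (D : set R[i]) (f : R[i] -> R[i]) : Prop :=
  forall z, D z -> derivable (f : R[i]^o -> R[i]^o) z 1.

Definition modc (z : R[i]) : R := Normc.normc z.

Definition orlicz_modular (Phi : R -> R) (gamma : R) (f : R[i] -> R[i])
    (lam : R) : \bar R :=
  (\int[(@lebesgue_measure R) \x (@lebesgue_measure R)]_(p in upper_half_plane_R2)
     ((Phi (modc (f (Complex p.1 p.2)) / lam) * (p.2 `^ gamma))%R%:E))%E.

Definition in_bergman_orlicz (Phi : R -> R) (gamma : R) (f : R[i] -> R[i]) : Prop :=
  holomorphic_on upper_half_plane f /\ (orlicz_modular Phi gamma f 1 < +oo)%E.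

Definition lux_norm (Phi : R -> R) (gamma : R) (f : R[i] -> R[i]) : R :=
  inf [set lam : R | 0 < lam /\ (orlicz_modular Phi gamma f lam <= 1)%E].

Definition continuous_embedding (Phi1 : R -> R) (alpha : R)
    (Phi2 : R -> R) (beta : R) : Prop :=
  exists2 C' : R, 0 < C' &
    forall f, in_bergman_orlicz Phi1 alpha f ->
      in_bergman_orlicz Phi2 beta f /\
      lux_norm Phi2 beta f <= C' * lux_norm Phi1 alpha f.

End Defs.

(* Main.v *)
Require Import Defs.
From mathcomp Require Import all_boot all_order all_algebra.
From mathcomp Require Import all_classical all_reals all_analysis.
From mathcomp Require Import measurable_realfun complex ring lra.
Import numFieldNormedType.Exports.
Import Order.TTheory GRing.Theory Num.Theory.

Set Implicit Arguments.
Unset Strict Implicit.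
Unset Printing Implicit Defensive.

(** Sufficiency. Cauchy's formula over rectangles gives
    [r ^ 2 * |f z| <= 8 * int_Q |f|] for a square [Q] of half-side [r] centred
    at [z]; by convexity of [Phi1] this becomes the pointwise estimate
    [Phi1 (|f z| / (K * lam)) * y ^ (2 + alpha) <= 1] whenever the modular of
    [f / lam] is at most 1. With [t = 1 / y] the hypothesis on the inverses
    bounds [Phi2 / Phi1] at the value [|f z| / (K * lam)] by
    [C * y ^ (alpha - beta)], since [Phi2 / Phi1] is nondecreasing, so the
    modular for [Phi2] is dominated by the one for [Phi1].

    Necessity. The functions [s * (c / (w + i c)) ^ n] with
    [Phi1 s = c ^ (- (2 + alpha))] and [n] large have Luxemburg norms bounded
    independently of [c]; the pointwise estimate for [Phi2] at [w = i c] then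
    gives the inequality between the inverses at [t = 1 / c]. *)

Local Open Scope classical_set_scope.
Local Open Scope ring_scope.

(** Holomorphy is given as complex differentiability at each point, without continuity of the
    derivative, so Green's theorem cannot be invoked: boundary integrals are shown to vanish by
    bisecting rectangles. Only the real form [Im (g dw) = Im g dx + Re g dy] is integrated. For
    [g w = f w / (w - z)] it sees only the real part of [f z]; the imaginary part comes from [i f],
    and the constant 8 is 4 for each of the two. The crude lower bound 4 stands in for the full
    angle [2 pi].

    The constant of the pointwise estimate depends on the exponent of the weight alone, so the same
    estimate serves [Phi1] in one direction and [Phi2] in the other. The remaining losses are
    dilations of the argument by fixed factors. Convexity absorbs them where a modular has to be
    brought below 1; the upper type of [Phi2] absorbs them where [Phi2 t] has to be bounded by a
    multiple of [Phi2 (t / k)]. The latter disposes of the factor [2 ^ n] lost because the test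
    function takes the value [s / 2 ^ n], not [s], at [i c]. *)

Local Notation normc := Normc.normc.

(** * Goursat theorem for closed 1-forms on rectangles *)

Section Rint.
Context {R : realType}.
Implicit Types (f g : R -> R) (a b c d e k m : R).

(** Continuity is two-sided even at the end points. This is stronger than continuity within the
    segment, and is what differentiability at every point of a closed rectangle provides. *)
Definition cont_on f a b := forall x, a <= x -> x <= b -> {for x, continuous f}.

Definition Rint f a b : R := \int[@lebesgue_measure R]_(x in `[a, b]) f x.

Lemma cont_on_integrable f a b : cont_on f a b ->
  (@lebesgue_measure R).-integrable `[a, b] (EFin \o f).
Proof.
move=> cf; apply: continuous_compact_integrable; first exact: segment_compact.
apply: continuous_in_subspaceT => x; rewrite inE /= in_itv /= => /andP[ax xb].
exact: cf.
Qed.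

Lemma cont_onB f g a b : cont_on f a b -> cont_on g a b ->
  cont_on (fun x => f x - g x) a b.
Proof. by move=> cf cg x ax xb; apply: continuousB; [exact: cf|exact: cg]. Qed.

Lemma cont_on_sub f a b a' b' : a <= a' -> b' <= b -> cont_on f a b ->
  cont_on f a' b'.
Proof. by move=> h1 h2 cf x ? ?; apply: cf; lra. Qed.

Lemma lebesgue_segment a b : a <= b ->
  (@lebesgue_measure R) `[a, b]%classic = (b - a)%:E.
Proof.
move=> ab; rewrite lebesgue_measure_itv/= lte_fin.
by case: ltgtP ab => // ->; rewrite subrr.
Qed.

Lemma Rint_cst k a b : a <= b -> Rint (fun=> k) a b = k * (b - a).
Proof.
move=> ab; rewrite /Rint Rintegral_cst//; congr (_ * _).
by have := congr1 fine (lebesgue_segment ab).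
Qed.

Lemma cont_on_cst k a b : cont_on (fun=> k) a b.
Proof. by move=> x _ _; exact: cst_continuous. Qed.

Lemma RintD f g a b : cont_on f a b -> cont_on g a b ->
  Rint (fun x => f x + g x) a b = Rint f a b + Rint g a b.
Proof.
by move=> cf cg; rewrite /Rint RintegralD//; exact: cont_on_integrable.
Qed.

Lemma le_Rint f g a b : cont_on f a b -> cont_on g a b ->
  (forall x, a <= x -> x <= b -> f x <= g x) -> Rint f a b <= Rint g a b.
Proof.
move=> cf cg fg; apply: le_Rintegral => //; try exact: cont_on_integrable.
by move=> x /=; rewrite in_itv /= => /andP[ax xb]; exact: fg.
Qed.

Lemma RintZ k f a b : cont_on f a b -> Rint (fun x => k * f x) a b = k * Rint f a b.
Proof. by move=> cf; rewrite /Rint RintegralZl//; exact: cont_on_integrable. Qed.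

Lemma cont_onD f g a b : cont_on f a b -> cont_on g a b ->
  cont_on (fun x => f x + g x) a b.
Proof. by move=> cf cg x ax xb; apply: continuousD; [exact: cf|exact: cg]. Qed.

Lemma cont_onZ k f a b : cont_on f a b -> cont_on (fun x => k * f x) a b.
Proof.
move=> cf x ax xb; apply: continuousM; [exact: cst_continuous|exact: cf].
Qed.

Lemma norm_Rint_le f g a b : a <= b -> cont_on f a b -> cont_on g a b ->
  (forall x, a <= x -> x <= b -> `|f x| <= g x) -> `|Rint f a b| <= Rint g a b.
Proof.
move=> ab cf cg fg; rewrite ler_norml lerNl -subr_ge0 opprK addrC -RintD//.
rewrite -(mul0r (b - a)) -(Rint_cst 0 ab); apply/andP; split; apply: le_Rint => //.
- exact: cont_on_cst.
- exact: cont_onD.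
- by move=> x ax xb; have := fg x ax xb; rewrite ler_norml => /andP[]; lra.
- by move=> x ax xb; have := fg x ax xb; rewrite ler_norml => /andP[].
Qed.

Lemma Rint_near k e f a b : a <= b -> cont_on f a b ->
  (forall x, a <= x -> x <= b -> `|f x - k| <= e) ->
  `|Rint f a b - k * (b - a)| <= e * (b - a).
Proof.
move=> ab cf H; rewrite ler_distl; apply/andP; split.
- rewrite -mulrBl -Rint_cst//; apply: le_Rint => //; first exact: cont_on_cst.
  by move=> x ax xb; have := H x ax xb; rewrite ler_norml => /andP[]; lra.
- rewrite -mulrDl -Rint_cst//; apply: le_Rint => //; first exact: cont_on_cst.
  by move=> x ax xb; have := H x ax xb; rewrite ler_norml => /andP[]; lra.
Qed.

Lemma Rint_split m f a b : a <= m -> m <= b -> cont_on f a b ->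
  Rint f a b = Rint f a m + Rint f m b.
Proof.
move=> am mb cf; rewrite /Rint.
have := @Rintegral_itvB R f (BLeft a) (BRight b) m (cont_on_integrable cf).
rewrite !bnd_simp => /(_ am mb) H.
rewrite -(@Rintegral_itv_obnd_cbnd R m (BRight b)) -?H; first lra.
apply: integrableS (cont_on_integrable cf) => //.
by apply: subset_itvr; rewrite bnd_simp.
Qed.

Lemma eq_Rint f g a b : (forall x, a <= x -> x <= b -> f x = g x) ->
  Rint f a b = Rint g a b.
Proof.
move=> fg; apply: eq_Rintegral => x; rewrite inE /= in_itv /= => /andP[ax xb].
exact: fg.
Qed.

End Rint.

(** * Boundary integrals of closed forms *)

Section Goursat.
Context {R : realType}.
Implicit Types (P Q : R -> R -> R) (a b c d e : R).

(** Each coefficient is continuous only in the direction in which it is integrated: [P] along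
    horizontal lines, [Q] along vertical ones. *)
Definition form_cont P Q a b c d := forall x y, a <= x -> x <= b ->
  c <= y -> y <= d -> {for x, continuous (P^~ y)} /\ {for y, continuous (Q x)}.

(** The integral of [P dx + Q dy] over the boundary of [a, b] x [c, d], traversed
    counterclockwise. *)
Definition rect_int P Q a b c d : R :=
  Rint (fun x => P x c - P x d) a b + Rint (fun y => Q b y - Q a y) c d.

Lemma form_cont_sub P Q a b c d a' b' c' d' :
  a <= a' -> b' <= b -> c <= c' -> d' <= d ->
  form_cont P Q a b c d -> form_cont P Q a' b' c' d'.
Proof. by move=> ? ? ? ? H x y ? ? ? ?; apply: H; lra. Qed.

Lemma form_contP P Q a b c d y : c <= y -> y <= d -> form_cont P Q a b c d ->
  cont_on (P^~ y) a b.
Proof. by move=> ? ? H x ? ?; have [] := H x y. Qed.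

Lemma form_contQ P Q a b c d x : a <= x -> x <= b -> form_cont P Q a b c d ->
  cont_on (Q x) c d.
Proof. by move=> ? ? H y ? ?; have [] := H x y. Qed.

(** The two integrals of [Q] along the cut [x = m] cancel. *)
Lemma rect_int_splitx P Q m a b c d : a <= m -> m <= b ->
  cont_on (P^~ c) a b -> cont_on (P^~ d) a b ->
  cont_on (Q a) c d -> cont_on (Q m) c d -> cont_on (Q b) c d ->
  rect_int P Q a b c d = rect_int P Q a m c d + rect_int P Q m b c d.
Proof.
move=> am mb Pc Pd Qa Qm Qb; rewrite /rect_int (@Rint_split _ m)//; last first.
  exact: cont_onB.
have -> : Rint (fun y => Q b y - Q a y) c d =
   Rint (fun y => Q m y - Q a y) c d + Rint (fun y => Q b y - Q m y) c d.
  rewrite -RintD; [|exact: cont_onB..].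
  by apply: eq_Rint => y _ _; lra.
lra.
Qed.

Lemma rect_int_splity P Q m a b c d : c <= m -> m <= d ->
  cont_on (P^~ c) a b -> cont_on (P^~ m) a b -> cont_on (P^~ d) a b ->
  cont_on (Q a) c d -> cont_on (Q b) c d ->
  rect_int P Q a b c d = rect_int P Q a b c m + rect_int P Q a b m d.
Proof.
move=> cm md Pc Pm Pd Qa Qb; rewrite /rect_int (@Rint_split _ m _ c d)//;
  last exact: cont_onB.
have -> : Rint (fun x => P x c - P x d) a b =
   Rint (fun x => P x c - P x m) a b + Rint (fun x => P x m - P x d) a b.
  rewrite -RintD; [|exact: cont_onB..].
  by apply: eq_Rint => y _ _; lra.
lra.
Qed.

(** The boundary integrals of the four quarters add up to that of the rectangle, so one of them
    carries at least a quarter of its absolute value. *)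
Lemma exists_quarter P Q a b c d : a <= b -> c <= d -> form_cont P Q a b c d ->
  exists a' b' c' d', [/\ a <= a', b' <= b, c <= c', d' <= d &
    [/\ b' - a' = (b - a) / 2, d' - c' = (d - c) / 2 &
      `|rect_int P Q a b c d| <= 4 * `|rect_int P Q a' b' c' d'| ]].
Proof.
move=> ab cd H; pose m := (a + b) / 2; pose n := (c + d) / 2.
have [am mb] : a <= m /\ m <= b by rewrite /m; split; lra.
have [cn nd] : c <= n /\ n <= d by rewrite /n; split; lra.
have -> : rect_int P Q a b c d =
  rect_int P Q a m c n + rect_int P Q a m n d +
  (rect_int P Q m b c n + rect_int P Q m b n d).
  have cP a' b' y : a <= a' -> b' <= b -> c <= y -> y <= d ->
      cont_on (P^~ y) a' b'.
    by move=> aa bb cy yd; apply: cont_on_sub aa bb _; exact: form_contP H.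
  have cQ x : a <= x -> x <= b -> cont_on (Q x) c d.
    by move=> ax xb; exact: form_contQ H.
  rewrite (rect_int_splitx (m := m))//; [|by auto..].
  rewrite (@rect_int_splity P Q n a m c d)//; [|by auto..].
  by rewrite (@rect_int_splity P Q n m b c d)//; auto.
set J1 := rect_int P Q a m c n; set J2 := rect_int P Q a m n d.
set J3 := rect_int P Q m b c n; set J4 := rect_int P Q m b n d.
have H1 : `|J1 + J2 + (J3 + J4)| <= `|J1| + `|J2| + `|J3| + `|J4|.
  have := ler_normD (J1 + J2) (J3 + J4).
  by have := ler_normD J1 J2; have := ler_normD J3 J4; lra.
have [ma mb'] : m - a = (b - a) / 2 /\ b - m = (b - a) / 2.
  by rewrite /m; split; lra.
have [nc nd'] : n - c = (d - c) / 2 /\ d - n = (d - c) / 2.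
  by rewrite /n; split; lra.
have [K1|K1] := leP (`|J1 + J2 + (J3 + J4)|) (4 * `|J1|).
  by exists a, m, c, n; split=> //; split.
have [K2|K2] := leP (`|J1 + J2 + (J3 + J4)|) (4 * `|J2|).
  by exists a, m, n, d; split=> //; split.
have [K3|K3] := leP (`|J1 + J2 + (J3 + J4)|) (4 * `|J3|).
  by exists m, b, c, n; split=> //; split.
exists m, b, n, d; split => //; split => //; rewrite -/J4.
by clear - H1 K1 K2 K3; lra.
Qed.

(** Differentiability of [P] and [Q] at the point itself, with [B] the common
    value of [dP/dy] and [dQ/dx]; no continuity of the derivatives is assumed. *)
Definition closed_at P Q x y := exists A B D : R, forall e, 0 < e ->
  exists2 dl : R, 0 < dl & forall x' y', `|x' - x| < dl -> `|y' - y| < dl ->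
  `|P x' y' - P x y - A * (x' - x) - B * (y' - y)|
     <= e * (`|x' - x| + `|y' - y|) /\
  `|Q x' y' - Q x y - B * (x' - x) - D * (y' - y)|
     <= e * (`|x' - x| + `|y' - y|).

Lemma lin_approx_continuous (h : R -> R) A x :
  (exists2 dl : R, 0 < dl & forall x', `|x' - x| < dl ->
    `|h x' - h x - A * (x' - x)| <= `|x' - x|) -> {for x, continuous h}.
Proof.
move=> [dl dl0 H]; apply/cvgrPdist_lt => e e0.
have A0 : 0 < `|A| + 1 by have := normr_ge0 A; lra.
near=> t.
have tx : `|t - x| < dl by near: t; apply: cvgr_distC_lt.
have te : `|t - x| < e / (`|A| + 1).
  by near: t; apply: cvgr_distC_lt => //; exact: divr_gt0.
have := H t tx; move: te; rewrite ltr_pdivlMr// => te h1.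
have h2 : `|A * (t - x)| = `|A| * `|t - x| by rewrite normrM.
rewrite distrC.
have : `|h t - h x| <= `|h t - h x - A * (t - x)| + `|A * (t - x)|.
  by apply: le_trans (ler_normD _ _); rewrite subrK.
move: te h1 h2; lra.
Unshelve. all: by end_near. Qed.

Lemma closed_at_cont P Q a b c d :
  (forall x y, a <= x -> x <= b -> c <= y -> y <= d -> closed_at P Q x y) ->
  form_cont P Q a b c d.
Proof.
move=> H x y ax xb cy yd; have [A [B [D K]]] := H x y ax xb cy yd.
have [dl dl0 {}K] := K 1 ltr01.
split.
- apply: (@lin_approx_continuous _ A); exists dl => // x' x'x.
  have [|+ _] := K x' y x'x; first by rewrite subrr normr0.
  by rewrite subrr normr0 mulr0 subr0 addr0 mul1r.
- apply: (@lin_approx_continuous _ D); exists dl => // y' y'y.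
  have [|_] := K x y' _ y'y; first by rewrite subrr normr0.
  by rewrite subrr normr0 mulr0 subr0 add0r mul1r.
Qed.

(** The linear parts of [P] and [Q] contribute [B * (c - d) * (b - a)] and [B * (b - a) * (d - c)],
    which cancel because both coefficients are the same [B]. What remains is the approximation
    error, at most [e / 2 * L] on each of the four sides. *)
Lemma closed_small_rect P Q p q e : closed_at P Q p q -> 0 < e ->
  exists2 dl : R, 0 < dl & forall a b c d, a <= p -> p <= b -> c <= q -> q <= d ->
   form_cont P Q a b c d -> (b - a) + (d - c) < dl ->
   `|rect_int P Q a b c d| <= e * ((b - a) + (d - c)) ^+ 2.
Proof.
move=> [A [B [D K]]] e0; have [dl dl0 {}K] := K (e / 2) ltac:(lra).
exists dl => // a b c d ap pb cq qd fc sm.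
set L := b - a + (d - c).
have L0 : 0 <= L by rewrite /L; lra.
have KP x y : a <= x -> x <= b -> c <= y -> y <= d ->
  `|P x y - P p q - A * (x - p) - B * (y - q)| <= e / 2 * L /\
  `|Q x y - Q p q - B * (x - p) - D * (y - q)| <= e / 2 * L.
  move=> ax xb cy yd.
  have hx : `|x - p| <= b - a by rewrite ler_norml; apply/andP; split; lra.
  have hy : `|y - q| <= d - c by rewrite ler_norml; apply/andP; split; lra.
  have [||h1 h2] := K x y; [lra|lra|].
  have h3 : e / 2 * (`|x - p| + `|y - q|) <= e / 2 * L.
    by apply: ler_wpM2l; [lra|rewrite /L; lra].
  by split; [exact: le_trans h1 h3|exact: le_trans h2 h3].
have H1 : `|Rint (fun x => P x c - P x d) a b - B * (c - d) * (b - a)| <=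
    e * L * (b - a).
  apply: Rint_near; first lra.
    by apply: cont_onB; apply: form_contP fc; lra.
  move=> x ax xb.
  have [k1 _] := KP x c ax xb ltac:(lra) ltac:(lra).
  have [k2 _] := KP x d ax xb ltac:(lra) ltac:(lra).
  have -> : P x c - P x d - B * (c - d) =
    (P x c - P p q - A * (x - p) - B * (c - q)) -
    (P x d - P p q - A * (x - p) - B * (d - q)) by ring.
  by apply: le_trans (ler_normB _ _) _; lra.
have H2 : `|Rint (fun y => Q b y - Q a y) c d - B * (b - a) * (d - c)| <=
    e * L * (d - c).
  apply: Rint_near; first lra.
    by apply: cont_onB; apply: form_contQ fc; lra.
  move=> y cy yd.
  have [_ k1] := KP b y ltac:(lra) ltac:(lra) cy yd.
  have [_ k2] := KP a y ltac:(lra) ltac:(lra) cy yd.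
  have -> : Q b y - Q a y - B * (b - a) =
    (Q b y - Q p q - B * (b - p) - D * (y - q)) -
    (Q a y - Q p q - B * (a - p) - D * (y - q)) by ring.
  by apply: le_trans (ler_normB _ _) _; lra.
rewrite /rect_int.
set I1 := Rint _ a b in H1 *; set I2 := Rint _ c d in H2 *.
have -> : I1 + I2 = (I1 - B * (c - d) * (b - a)) + (I2 - B * (b - a) * (d - c)).
  by ring.
apply: le_trans (ler_normD _ _) _; apply: le_trans (lerD H1 H2) _.
by rewrite -mulrDr -/L expr2 mulrA.
Qed.

Lemma nested_intervals (a b : R^nat) :
  (forall n, a n <= a n.+1) -> (forall n, b n.+1 <= b n) ->
  (forall n, a n <= b n) -> exists p, forall n, a n <= p /\ p <= b n.
Proof.
move=> ha hb ab.
have ma n k : a n <= a (n + k)%N.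
  by elim: k => [|k IH]; rewrite ?addn0// addnS (le_trans IH).
have mb n k : b (n + k)%N <= b n.
  by elim: k => [|k IH]; rewrite ?addn0// addnS (le_trans _ IH).
have amb m n : a m <= b n.
  by apply: le_trans (ma m n) _; rewrite (le_trans (ab _))// addnC mb.
exists (sup (range a)) => n; split.
- apply: sup_upper_bound; last by exists n.
  by split; [exists (a 0%N), 0%N|exists (b 0%N) => _ [m _ <-]].
- apply: ge_sup; first by exists (a 0%N), 0%N.
  by move=> _ [m _ <-].
Qed.

(** After [n] bisections the chosen rectangle still carries a share [4 ^- n] of the integral, while
    closedness at the common point bounds its integral by [e * (L / 2 ^ n) ^ 2]. The powers cancel,
    leaving [e * L ^ 2] for every positive [e]. *)
Theorem goursat P Q a b c d : a <= b -> c <= d ->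
  (forall x y, a <= x -> x <= b -> c <= y -> y <= d -> closed_at P Q x y) ->
  rect_int P Q a b c d = 0.
Proof.
move=> ab cd H.
pose valid (r : R * R * R * R) :=
  let: (a', b', c', d') := r in
  [/\ a <= a', b' <= b, c <= c', d' <= d & a' <= b' /\ c' <= d'].
pose sub (r' r : R * R * R * R) :=
  let: (a, b, c, d) := r in let: (a', b', c', d') := r' in
  [/\ a <= a', b' <= b, c <= c', d' <= d &
    [/\ b' - a' = (b - a) / 2, d' - c' = (d - c) / 2 &
      `|rect_int P Q a b c d| <= 4 * `|rect_int P Q a' b' c' d'| ]].
have fc := closed_at_cont H.
(* The selection must be a total function on quadruples; on those that are not subrectangles it
   returns its argument. *)
have [f fP] : {f & forall r, valid r -> valid (f r) /\ sub (f r) r}.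
  apply: (@choice _ _ (fun r r' => valid r -> valid r' /\ sub r' r)).
  move=> [[[a1 b1] c1] d1].
  have [v|nv] := pselect (valid (a1, b1, c1, d1)); last first.
    by exists (a1, b1, c1, d1).
  have [? ? ? ? [? ?]] := v.
  have [|||a' [b' [c' [d' K]]]] := @exists_quarter P Q a1 b1 c1 d1 => //.
    by apply: form_cont_sub fc.
  exists (a', b', c', d') => _; split => //.
  have [k1 k2 k3 k4 [k5 k6 _]] := K; split.
  - exact: le_trans k1.
  - exact: le_trans k2 _.
  - exact: le_trans k3.
  - exact: le_trans k4 _.
  - by rewrite -subr_ge0 -(subr_ge0 c') k5 k6 !divr_ge0 ?subr_ge0.
pose r n := iter n f (a, b, c, d).
have rv n : valid (r n).
  by elim: n => [|n IH]; [split => //; split|have [] := fP _ IH].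
have rs n : sub (r n.+1) (r n) by have [] := fP _ (rv n).
pose an n := (r n).1.1.1; pose bn n := (r n).1.1.2.
pose cn n := (r n).1.2; pose dn n := (r n).2.
have rE n : r n = (an n, bn n, cn n, dn n).
  by rewrite /an /bn /cn /dn; case: (r n) => -[[]].
have rv' n : [/\ a <= an n, bn n <= b, c <= cn n, dn n <= d &
    an n <= bn n /\ cn n <= dn n] by have := rv n; rewrite rE.
have rs' n : [/\ an n <= an n.+1, bn n.+1 <= bn n, cn n <= cn n.+1,
    dn n.+1 <= dn n & [/\ bn n.+1 - an n.+1 = (bn n - an n) / 2,
     dn n.+1 - cn n.+1 = (dn n - cn n) / 2 &
      `|rect_int P Q (an n) (bn n) (cn n) (dn n)| <=
        4 * `|rect_int P Q (an n.+1) (bn n.+1) (cn n.+1) (dn n.+1)| ]].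
  by have := rs n; rewrite !rE.
have [p pP] : exists p, forall n, an n <= p /\ p <= bn n.
  by apply: nested_intervals => n; have := rs' n; have := rv' n => -[? ? ? ? []] ? ? [].
have [q qP] : exists q, forall n, cn n <= q /\ q <= dn n.
  by apply: nested_intervals => n; have := rs' n; have := rv' n => -[? ? ? ? []] ? ? [].
set L := (b - a) + (d - c).
have LE n : bn n - an n + (dn n - cn n) = L / 2 ^+ n.
  elim: n => [|n IH]; first by rewrite expr0 divr1.
  have [_ _ _ _ [-> -> _]] := rs' n.
  by rewrite -mulrDl IH exprS invfM; ring.
have JE n : `|rect_int P Q a b c d| <=
    4 ^+ n * `|rect_int P Q (an n) (bn n) (cn n) (dn n)|.
  elim: n => [|n IH]; first by rewrite expr0 mul1r.
  have [_ _ _ _ [_ _ h]] := rs' n.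
  apply: le_trans IH _; rewrite exprSr -mulrA ler_wpM2l//.
have L0 : 0 <= L by rewrite /L; lra.
have key e : 0 < e -> `|rect_int P Q a b c d| <= e * L ^+ 2.
  move=> e0.
  have [|dl dl0 K] := @closed_small_rect P Q p q e _ e0.
    have [p1 p2] := pP 0%N; have [q1 q2] := qP 0%N.
    have [v1 v2 v3 v4 _] := rv' 0%N.
    by apply: H; [exact: le_trans p1|exact: le_trans v2|exact: le_trans q1|
      exact: le_trans v4].
  have [n nP] : exists n, L / 2 ^+ n < dl.
    have [n nP] := ltr_add_invr (y := 0) (x := dl / (L + 1)) ltac:(apply: divr_gt0; lra).
    exists n; rewrite add0r in nP.
    rewrite ltr_pdivrMr ?exprn_gt0//.
    have h1 : (n.+1%:R : R) <= 2 ^+ n by rewrite -natrX ler_nat ltn_expl.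
    rewrite ltr_pdivlMr in nP; last lra.
    have h2 : L < dl * n.+1%:R.
      rewrite -ltr_pdivrMr//; apply: le_lt_trans nP; rewrite mulrC.
      by apply: ler_wpM2l; [rewrite invr_ge0|lra].
    by apply: lt_le_trans h2 _; rewrite ler_wpM2l// ltW.
  have [p1 p2] := pP n; have [q1 q2] := qP n; have [? ? ? ? [? ?]] := rv' n.
  have := K (an n) (bn n) (cn n) (dn n) p1 p2 q1 q2.
  rewrite LE => /(_ _ nP) h.
  apply: le_trans (JE n) _.
  have /h {}h : form_cont P Q (an n) (bn n) (cn n) (dn n).
    by apply: form_cont_sub fc.
  apply: le_trans (ler_wpM2l _ h) _; first by rewrite exprn_ge0.
  rewrite expr_div_n mulrCA ler_wpM2l//; first exact: ltW.
  rewrite -exprM mulnC exprM (_ : 2 ^+ 2 = 4); last by rewrite -natrX.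
  have n4 : (4 : R) ^+ n != 0 by rewrite expf_neq0.
  by rewrite mulrCA divff// mulr1.
apply/normr0_eq0/eqP; rewrite eq_le normr_ge0 andbT.
apply/ler_addgt0Pl => e e0; rewrite addr0.
have L2 : 0 < L ^+ 2 + 1 by have := sqr_ge0 L; lra.
apply: le_trans (key (e / (L ^+ 2 + 1)) _) _; first exact: divr_gt0.
rewrite mulrAC ler_pdivrMr// ler_wpM2l//; lra.
Qed.

(** The frame between the rectangles is cut into two strips of full height at the left and right and
    two pieces below and above the inner rectangle. The form is closed on each of these, so
    [goursat] removes them. *)
Lemma rect_int_frame P Q a b c d a' b' c' d' :
  a <= a' -> a' <= b' -> b' <= b -> c <= c' -> c' <= d' -> d' <= d ->
  (forall x y, a <= x -> x <= b -> c <= y -> y <= d ->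
     [\/ x <= a', b' <= x, y <= c' | d' <= y] -> closed_at P Q x y) ->
  rect_int P Q a b c d = rect_int P Q a' b' c' d'.
Proof.
move=> aa ab' bb cc cd' dd H.
have aa'b : a' <= b by exact: le_trans bb.
have ab'b : a <= b' by exact: le_trans ab'.
have cc'd : c' <= d by exact: le_trans dd.
have cd'd : c <= d' by exact: le_trans cd'.
have cP p q y : a <= p -> q <= b -> c <= y -> y <= d -> y <= c' \/ d' <= y ->
    cont_on (P^~ y) p q.
  (* The degenerate rectangle [[p, q] x [y, y]] yields continuity along a single horizontal line. *)
  move=> ap qb cy yd out; apply: (@form_contP P Q p q y y) => //.
  apply: closed_at_cont => x t px xq yt ty.
  have -> : t = y by apply/eqP; rewrite eq_le ty.
  apply: H => //; [exact: le_trans px|exact: le_trans qb|].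
  by case: out => ?; [apply: Or43|apply: Or44].
have cQ p q x : c <= p -> q <= d -> a <= x -> x <= b -> x <= a' \/ b' <= x ->
    cont_on (Q x) p q.
  move=> ap qb cy yd out; apply: (@form_contQ P Q x x p q) => //.
  apply: closed_at_cont => t y xt tx py yq.
  have -> : t = x by apply/eqP; rewrite eq_le tx.
  apply: H => //; [exact: le_trans py|exact: le_trans qb|].
  by case: out => ?; [apply: Or41|apply: Or42].
have cdle : c <= d by exact: le_trans cc'd.
have able : a <= b by exact: le_trans aa'b.
rewrite (@rect_int_splitx P Q a' a b c d)//; first last.
1-5: by auto.
rewrite (@rect_int_splitx P Q b' a' b c d)//; first last.
1-5: by auto.
rewrite (@rect_int_splity P Q c' a' b' c d)//; first last.
1-5: by auto.
rewrite (@rect_int_splity P Q d' a' b' c' d)//; first last.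
1-5: by auto.
rewrite (@goursat P Q a a' c d)//; last first.
  move=> x y ax xa cy yd; apply: H => //; first exact: le_trans aa'b.
  exact: Or41.
rewrite (@goursat P Q b' b c d)//; last first.
  move=> x y ax xa cy yd; apply: H => //; first exact: le_trans ax.
  exact: Or42.
rewrite (@goursat P Q a' b' c c')//; last first.
  move=> x y ax xa cy yd; apply: H => //; last exact: Or43.
  - exact: le_trans ax.
  - exact: le_trans bb.
  - exact: le_trans cc'd.
rewrite (@goursat P Q a' b' d' d)//; last first.
  move=> x y ax xa cy yd; apply: H => //; last exact: Or44.
  - exact: le_trans ax.
  - exact: le_trans bb.
  - exact: le_trans cy.
by rewrite !add0r !addr0.
Qed.

End Goursat.

(** * Cauchy kernel on rectangles *)

Section Complex.
Context {R : realType}.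
Implicit Types (f g : R[i] -> R[i]) (z w : R[i]) (a b c d e x y : R).

Lemma normc_Complex x y : normc (Complex x y) = Num.sqrt (x ^+ 2 + y ^+ 2).
Proof. by []. Qed.

Lemma normc_ge0 z : 0 <= normc z.
Proof. by case: z => x y; rewrite sqrtr_ge0. Qed.

Lemma normc_Re z : `|complex.Re z| <= normc z.
Proof.
case: z => x y /=; rewrite -sqrtr_sqr ler_sqrt ?addr_ge0 ?sqr_ge0//.
by rewrite lerDl sqr_ge0.
Qed.

Lemma normc_Im z : `|complex.Im z| <= normc z.
Proof.
case: z => x y /=; rewrite -sqrtr_sqr ler_sqrt ?addr_ge0 ?sqr_ge0//.
by rewrite lerDr sqr_ge0.
Qed.

Lemma normc_le z : normc z <= `|complex.Re z| + `|complex.Im z|.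
Proof.
case: z => x y /=.
rewrite -[leRHS]ger0_norm ?addr_ge0// -sqrtr_sqr ler_sqrt ?sqr_ge0//.
rewrite sqrrD !real_normK ?num_real// addrAC lerDl mulrn_wge0//.
Qed.

Lemma normr_normc z : `|z| = (normc z)%:C%C.
Proof. by rewrite normc_def; case: z. Qed.

(** Complex differentiability in epsilon-delta form, with real [e] and [dl] and the real-valued
    modulus. *)
Definition cderiv g w := exists D : R[i], forall e, 0 < e ->
  exists2 dl : R, 0 < dl & forall w', normc (w' - w) < dl ->
    normc (g w' - g w - D * (w' - w)) <= e * normc (w' - w).

Lemma derivable_cderiv g w : derivable (g : R[i]^o -> R[i]^o) w 1 -> cderiv g w.
Proof.
move=> dg; have /cvgrPdist_le/= := dg; set D := lim _ => H.
exists D => e e0.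
have eC : (0 : R[i]) < e%:C%C by rewrite ltcR.
have [dl /= dl0 K] := H _ eC.
(* The radius is an element of [R[i]]; being positive, it is real. *)
have [d1 d1E] : exists d1, dl = d1%:C%C.
  by apply/complex_realP; exact: gtr0_real.
move: dl0 K; rewrite {}d1E ltcR => d0 K.
exists d1 => // w' w'w.
have [->|nw] := eqVneq w' w; first by rewrite !subrr mulr0 subrr Normc.normc0 mulr0.
have nw0 : w' - w != 0 by rewrite subr_eq0.
have nw1 : 0 < normc (w' - w).
  rewrite lt_neqAle normc_ge0 andbT eq_sym; apply/eqP => /Normc.eq0_normc/eqP.
  by apply/negP.
have := K (w' - w); rewrite /ball_/= sub0r normrN !normr_normc !ltcR.
move=> /(_ w'w nw0); rewrite [_%:A]mulr1 subrK lecR => h.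
rewrite -ler_pdivrMr// -Normc.normcV -Normc.normcM.
have -> : (g w' - g w - D * (w' - w)) / (w' - w) =
    - (D - (w' - w)^-1 *: (g w' - g w : R[i]^o)).
  by rewrite opprB [in RHS]/GRing.scale/= mulrBl mulfK// [(_ - _)^-1 * _]mulrC.
by rewrite normcN.
Qed.

Lemma cderiv_lip g x y : cderiv g (Complex x y) -> exists2 M : R, 0 < M &
  exists2 dl : R, 0 < dl & forall x' y', `|x' - x| < dl -> `|y' - y| < dl ->
  normc (g (Complex x' y') - g (Complex x y)) <= M * (`|x' - x| + `|y' - y|).
Proof.
move=> [D H]; exists (normc D + 1); first by have := normc_ge0 D; lra.
have [dl dl0 K] := H 1 ltr01; exists (dl / 2); first lra.
move=> x' y' x'x y'y.
have h1 : normc (Complex x' y' - Complex x y) <= `|x' - x| + `|y' - y|.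
  exact: normc_le.
have := K (Complex x' y') ltac:(lra).
set w' := Complex x' y' in h1 *; set w := Complex x y in h1 *.
rewrite mul1r => h2.
have -> : g w' - g w = (g w' - g w - D * (w' - w)) + D * (w' - w) by ring.
apply: le_trans (le_normcD _ _) _; rewrite Normc.normcM.
have h3 : normc D * normc (w' - w) <= normc D * (`|x' - x| + `|y' - y|).
  by rewrite ler_wpM2l// normc_ge0.
by move: h1 h2 h3; lra.
Qed.

Lemma ler_normc_sub z w : `|normc z - normc w| <= normc (z - w).
Proof.
have h1 := le_normcD (z - w) w; have h2 := le_normcD (w - z) z.
rewrite !subrK in h1 h2; rewrite -(normcN (w - z)) opprB in h2.
by rewrite ler_norml; apply/andP; split; lra.
Qed.

Lemma cderiv_continuous g x y : cderiv g (Complex x y) ->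
  {for (x, y), continuous (fun p : R * R => normc (g (Complex p.1 p.2)))}.
Proof.
move=> /cderiv_lip[M M0 [dl dl0 K]]; apply/cvgrPdist_lt => e e0.
pose r := Num.min dl (e / (2 * M)).
have r0 : 0 < r by rewrite lt_min dl0 divr_gt0// mulr_gt0.
exists (ball x r, ball y r); first by split; exact: nbhsx_ballx.
move=> [x' y'] [/= hx hy].
rewrite /ball/= distrC in hx; rewrite /ball/= distrC in hy.
have [rd rM] : r <= dl /\ r <= e / (2 * M).
  by rewrite /r !ge_min !lexx orbT.
rewrite distrC; apply: le_lt_trans (ler_normc_sub _ _) _.
apply: le_lt_trans (K _ _ (lt_le_trans hx rd) (lt_le_trans hy rd)) _.
rewrite mulrC -ltr_pdivlMr//.
have -> : e / M = e / (2 * M) + e / (2 * M) by field; rewrite gt_eqF.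
by apply: ltrD; exact: lt_le_trans rM.
Qed.

Lemma cderiv_cont_x g x y : cderiv g (Complex x y) ->
  {for x, continuous (fun t => normc (g (Complex t y)))}.
Proof.
move=> /cderiv_continuous H.
apply: (@continuous_comp _ _ _ (fun t => (t, y))
  (fun p : R * R => normc (g (Complex p.1 p.2)))) => //.
exact: (@cvg_pair _ _ _ _ (nbhs x) (nbhs y) _ _ _ id (cst y) cvg_id (cvg_cst y)).
Qed.

Lemma cderiv_cont_y g x y : cderiv g (Complex x y) ->
  {for y, continuous (fun t => normc (g (Complex x t)))}.
Proof.
move=> /cderiv_continuous H.
apply: (@continuous_comp _ _ _ (fun t => (x, t))
  (fun p : R * R => normc (g (Complex p.1 p.2)))) => //.
exact: (@cvg_pair _ _ _ _ (nbhs x) (nbhs y) _ _ _ (cst x) id (cvg_cst x) cvg_id).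
Qed.

(** These are the coefficients of [Im (g dw)]. By the Cauchy-Riemann equations the [y]-derivative of
    [Im g] and the [x]-derivative of [Re g] are both the real part of the complex derivative. *)
Lemma cderiv_closed_at g x y : cderiv g (Complex x y) ->
  closed_at (fun x y => complex.Im (g (Complex x y)))
            (fun x y => complex.Re (g (Complex x y))) x y.
Proof.
move=> [D H]; exists (complex.Im D), (complex.Re D), (- complex.Im D) => e e0.
have [dl dl0 K] := H e e0; exists (dl / 2); first lra.
move=> x' y' x'x y'y.
have h1 : normc (Complex x' y' - Complex x y) <= `|x' - x| + `|y' - y|.
  exact: normc_le.
have := K (Complex x' y') ltac:(lra).
set w' := Complex x' y' in h1 *; set w := Complex x y in h1 *.
move=> h2.
have h3 : e * normc (w' - w) <= e * (`|x' - x| + `|y' - y|).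
  by rewrite ler_wpM2l// ltW.
have := normc_Re (g w' - g w - D * (w' - w)).
have := normc_Im (g w' - g w - D * (w' - w)).
have -> : complex.Im (g w' - g w - D * (w' - w)) =
  complex.Im (g w') - complex.Im (g w) - complex.Im D * (x' - x)
  - complex.Re D * (y' - y).
  rewrite /w /w'; case: (g _) => ? ?; case: (g _) => ? ?.
  by case: D {H K h2} => ? ? /=; ring.
have -> : complex.Re (g w' - g w - D * (w' - w)) =
  complex.Re (g w') - complex.Re (g w) - complex.Re D * (x' - x)
  - - complex.Im D * (y' - y).
  rewrite /w /w'; case: (g _) => ? ?; case: (g _) => ? ?.
  by case: D {H K h2} => ? ? /=; ring.
by move=> h4 h5; split; lra.
Qed.

End Complex.

(** * Differentiability of quotients by powers of [t - z] *)

Section NumFieldDerivable.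
Variable K : numFieldType.

Lemma derivable_kernel (f : K^o -> K^o) (w z : K) : w != z ->
  derivable f w 1 -> derivable (fun t : K^o => f t * (t - z)^-1 : K^o) w 1.
Proof.
move=> wz df.
have dB : derivable (fun t : K^o => t - z : K^o) w 1.
  exact: (@derivableB K K^o K^o id (cst z)).
apply: (@derivableM K K^o f (fun t => (t - z)^-1)) => //.
by apply: (@derivableV K K^o (fun t => t - z)) => //; rewrite subr_eq0.
Qed.

Lemma derivable_cstM (f : K^o -> K^o) (w k : K) :
  derivable f w 1 -> derivable (fun t : K^o => k * f t : K^o) w 1.
Proof.
move=> df; exact: (@derivableM K K^o (cst k) f).
Qed.

Lemma derivable_kernelX (w k z : K) n : w != z ->
  derivable (fun t : K^o => k * (t - z)^-1 ^+ n : K^o) w 1.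
Proof.
move=> wz; apply: derivable_cstM; elim: n => [|n IH].
  by under eq_fun do rewrite expr0; exact: derivable_cst.
by under eq_fun do rewrite exprSr; apply: derivable_kernel.
Qed.

End NumFieldDerivable.

(** * Cauchy's formula as an inequality over the edges of a rectangle *)

Section CauchyKernel.
Context {R : realType} (f : R[i] -> R[i]) (x0 y0 a b c d : R).
Hypothesis df : forall x y, a <= x -> x <= b -> c <= y -> y <= d ->
  derivable (f : R[i]^o -> R[i]^o) (Complex x y) 1.

Let z := Complex x0 y0.
Let g w := f w * (w - z)^-1.
Let P x y := complex.Im (g (Complex x y)).
Let Q x y := complex.Re (g (Complex x y)).

Let closed_off x y : a <= x -> x <= b -> c <= y -> y <= d ->
  (x != x0) || (y != y0) -> closed_at P Q x y.
Proof.
move=> ax xb cy yd ne; apply/cderiv_closed_at/derivable_cderiv/(@derivable_kernel R[i]).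
  by rewrite eq_complex/= negb_and.
exact: df.
Qed.

Let contP y a' b' : c <= y -> y <= d -> y != y0 -> a <= a' -> b' <= b ->
  cont_on (P^~ y) a' b'.
Proof.
move=> cy yd ne aa bb; apply: (@form_contP _ P Q a' b' y y) => //.
apply: closed_at_cont => x' y' ? ? ? ?.
have -> : y' = y by lra.
by apply: closed_off => //; [lra|lra|rewrite ne orbT].
Qed.

Let contQ x c' d' : a <= x -> x <= b -> x != x0 -> c <= c' -> d' <= d ->
  cont_on (Q x) c' d'.
Proof.
move=> ax xb ne cc dd; apply: (@form_contQ _ P Q x x c' d') => //.
apply: closed_at_cont => x' y' ? ? ? ?.
have -> : x' = x by lra.
by apply: closed_off => //; [lra|lra|rewrite ne].
Qed.

Let rect_int_square s : 0 < s -> a <= x0 - s -> x0 + s <= b ->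
  c <= y0 - s -> y0 + s <= d ->
  rect_int P Q a b c d =
  rect_int P Q (x0 - s) (x0 + s) (y0 - s) (y0 + s).
Proof.
move=> s0 h1 h2 h3 h4.
have sx : x0 - s < x0 /\ x0 < x0 + s by split; lra.
have sy : y0 - s < y0 /\ y0 < y0 + s by split; lra.
case: sx sy => sx1 sx2 [sy1 sy2].
apply: rect_int_frame => //.
- by apply: ltW; exact: lt_trans sx2.
- by apply: ltW; exact: lt_trans sy2.
move=> x y ax xb cy yd out; apply: closed_off => //.
case: out => h.
- by rewrite lt_eqF//; exact: le_lt_trans sx1.
- by rewrite gt_eqF//; exact: lt_le_trans h.
- by rewrite orbC lt_eqF//; exact: le_lt_trans sy1.
- by rewrite orbC gt_eqF//; exact: lt_le_trans h.
Qed.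

(** By differentiability at [z], [f w / (w - z)] differs from [f z / (w - z)] by the difference
    quotient of [f], which is bounded near [z]. The two fractions are the imaginary and real parts
    of [f z / (X + i Y)]. *)
Let kernel_near : a <= x0 -> x0 <= b -> c <= y0 -> y0 <= d ->
  exists2 M : R, 0 < M & exists2 dl : R, 0 < dl &
  forall X Y, `|X| < dl -> `|Y| < dl -> 0 < X ^+ 2 + Y ^+ 2 ->
  `|P (x0 + X) (y0 + Y) - (complex.Im (f z) * X - complex.Re (f z) * Y) /
                          (X ^+ 2 + Y ^+ 2)| <= M /\
  `|Q (x0 + X) (y0 + Y) - (complex.Re (f z) * X + complex.Im (f z) * Y) /
                          (X ^+ 2 + Y ^+ 2)| <= M.
Proof.
move=> ? ? ? ?.
have [|D /(_ _ ltr01)[dl dl0 K]] := @derivable_cderiv _ f z; first exact: df.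
exists (normc D + 1); first by have := normc_ge0 D; lra.
exists (dl / 2); first lra.
move=> X Y hX hY XY0.
have XYE : Complex (x0 + X) (y0 + Y) - z = Complex X Y.
  by rewrite /z; congr Complex; ring.
have XYn0 : Complex X Y != 0.
  apply: contraTneq XY0 => -[-> ->].
  by rewrite expr0n addr0 ltxx.
have := K (Complex (x0 + X) (y0 + Y)); rewrite XYE.
have h1 : normc (Complex X Y) <= `|X| + `|Y| by exact: normc_le.
move=> /(_ ltac:(lra)); set w := Complex (x0 + X) _.
rewrite mul1r => h2.
have n0 : 0 < normc (Complex X Y) by rewrite sqrtr_gt0.
have h3 : normc (g w - f z * (Complex X Y)^-1) <= normc D + 1.
  have -> : g w - f z * (Complex X Y)^-1 =
      (f w - f z - D * Complex X Y) * (Complex X Y)^-1 + D.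
    by rewrite /g XYE !mulrBl mulfK// subrK.
  apply: le_trans (le_normcD _ _) _; rewrite Normc.normcM Normc.normcV addrC.
  by rewrite lerD2l ler_pdivrMr// mul1r.
have EI : complex.Im (g w - f z * (Complex X Y)^-1) = P (x0 + X) (y0 + Y) -
   (complex.Im (f z) * X - complex.Re (f z) * Y) / (X ^+ 2 + Y ^+ 2).
  by rewrite /P -/w; case: (g w) => ? ?; case: (f z) => ? ? /=; ring.
have ER : complex.Re (g w - f z * (Complex X Y)^-1) = Q (x0 + X) (y0 + Y) -
   (complex.Re (f z) * X + complex.Im (f z) * Y) / (X ^+ 2 + Y ^+ 2).
  by rewrite /Q -/w; case: (g w) => ? ?; case: (f z) => ? ? /=; ring.
rewrite -EI -ER; split; apply: le_trans h3; [exact: normc_Im|exact: normc_Re].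
Qed.

Hypotheses (ax : a < x0) (xb : x0 < b) (cy : c < y0) (yd : y0 < d).

(** On a small square of half-side [s] around [z], [f w / (w - z)] differs from
    [f z / (w - z)] by a bounded amount, and the imaginary part of the integral of
    [dw / (w - z)] is the integral of [s / (s ^ 2 + t ^ 2) >= 1 / (2 s)] over sides
    of total length [8 s], hence at least 4. *)
Lemma rect_int_residue : 4 * `|complex.Re (f z)| <= `|rect_int P Q a b c d|.
Proof.
have [M M0 [dl dl0 K]] := kernel_near (ltW ax) (ltW xb) (ltW cy) (ltW yd).
have [e0 e0P] : exists2 e0 : R, 0 < e0 &
    [/\ a <= x0 - e0, x0 + e0 <= b, c <= y0 - e0, y0 + e0 <= d & e0 < dl].
  exists (Num.min (Num.min (x0 - a) (b - x0))
         (Num.min (Num.min (y0 - c) (d - y0)) (dl / 2))).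
    by rewrite !lt_min !subr_gt0 ax xb cy yd divr_gt0.
  set m := Num.min _ _.
  have : m <= m by [].
  rewrite {2}/m !le_min => /andP[/andP[? ?] /andP[/andP[? ?] ?]].
  by split; lra.
move=> [h1 h2 h3 h4 h5].
(* Each pair of opposite sides, of length [2 * s], contributes at least [2 * |u|] in absolute value,
   where [u] is the real part of [f z], up to an error [4 * M * s]. *)
have key s : 0 < s -> s <= e0 ->
    4 * `|complex.Re (f z)| <= `|rect_int P Q a b c d| + 8 * M * s.
  move=> s0 se.
  have [q1 q2] : a <= x0 - s /\ x0 + s <= b by split; lra.
  have [q3 q4] : c <= y0 - s /\ y0 + s <= d by split; lra.
  have [q5 q6] : a <= x0 + s /\ x0 - s <= b by split; lra.
  have [q7 q8] : c <= y0 + s /\ y0 - s <= d by split; lra.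
  rewrite (@rect_int_square s)//.
  set u := complex.Re (f z); set v := complex.Im (f z).
  have sdl : s < dl by exact: le_lt_trans h5.
  have ps : `|s| < dl by rewrite gtr0_norm.
  have ns : `|- s| < dl by rewrite normrN.
  (* When opposite sides are paired at the same parameter [X], the terms in [v * X] cancel and only
     [u * k] is left, with [k = 2 * s / (X ^ 2 + s ^ 2)]. *)
  have ks X : `|X| <= s -> exists k, [/\ s^-1 <= k,
     `|P (x0 + X) (y0 - s) - P (x0 + X) (y0 + s) - u * k| <= 2 * M &
     `|Q (x0 + s) (y0 + X) - Q (x0 - s) (y0 + X) - u * k| <= 2 * M].
    move=> Xs.
    have XX : X ^+ 2 <= s ^+ 2.
      by rewrite -real_normK ?num_real// lerXn2r// nnegrE ltW.
    have X0 := sqr_ge0 X; have s2 : 0 < s ^+ 2 by rewrite exprn_gt0.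
    have s3 : 0 < X ^+ 2 + s ^+ 2 by rewrite ltr_wpDl.
    have s3' : 0 < s ^+ 2 + X ^+ 2 by rewrite addrC.
    have Xdl : `|X| < dl by exact: le_lt_trans sdl.
    exists (2 * s / (X ^+ 2 + s ^+ 2)); split.
    - rewrite ler_pdivlMr// mulrC ler_pdivrMr//.
      by move: XX; rewrite !expr2; lra.
    - have [|k1 _] := K X (- s) Xdl ns; first by rewrite sqrrN.
      have [k2 _] := K X s Xdl ps s3.
      have -> : P (x0 + X) (y0 - s) - P (x0 + X) (y0 + s) -
         u * (2 * s / (X ^+ 2 + s ^+ 2)) =
        (P (x0 + X) (y0 - s) - (v * X - u * - s) / (X ^+ 2 + (- s) ^+ 2)) -
        (P (x0 + X) (y0 + s) - (v * X - u * s) / (X ^+ 2 + s ^+ 2)).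
        by rewrite sqrrN; field; rewrite !gt_eqF.
      by apply: le_trans (ler_normB _ _) _; rewrite -/u -/v in k1 k2; lra.
    - have [|_ k1] := K (- s) X ns Xdl; first by rewrite sqrrN.
      have [_ k2] := K s X ps Xdl s3'.
      have -> : Q (x0 + s) (y0 + X) - Q (x0 - s) (y0 + X) -
         u * (2 * s / (X ^+ 2 + s ^+ 2)) =
        (Q (x0 + s) (y0 + X) - (u * s + v * X) / (s ^+ 2 + X ^+ 2)) -
        (Q (x0 - s) (y0 + X) - (u * - s + v * X) / ((- s) ^+ 2 + X ^+ 2)).
        by rewrite sqrrN; field; rewrite !gt_eqF.
      by apply: le_trans (ler_normB _ _) _; rewrite -/u -/v in k1 k2; lra.
  have [sx1 sx2] : x0 - s != x0 /\ x0 + s != x0.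
    by split; apply/eqP; lra.
  have [sy1 sy2] : y0 - s != y0 /\ y0 + s != y0.
    by split; apply/eqP; lra.
  have cP : cont_on (fun x => P x (y0 - s) - P x (y0 + s)) (x0 - s) (x0 + s).
    by apply: cont_onB; exact: contP.
  have cQ : cont_on (fun y => Q (x0 + s) y - Q (x0 - s) y) (y0 - s) (y0 + s).
    by apply: cont_onB; exact: contQ.
  (* Only the lower bound [s^-1 <= k] is available, so the sign of [u] decides from which side the
     integrals are estimated. *)
  have [u0|/ltW u0] : 0 <= u \/ u < 0 by case: (lerP 0 u); [left|right].
  - rewrite [`|u|]ger0_norm//.
    have H1 : (u / s - 2 * M) * (x0 + s - (x0 - s)) <=
        Rint (fun x => P x (y0 - s) - P x (y0 + s)) (x0 - s) (x0 + s).
      rewrite -Rint_cst; last lra.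
      apply: le_Rint => //; first exact: cont_on_cst.
      move=> x ? ?; have [|k [k1 + _]] := ks (x - x0).
        by rewrite ler_norml; lra.
      rewrite subrKC ler_norml => /andP[].
      have := ler_wpM2l u0 k1; lra.
    have H2 : (u / s - 2 * M) * (y0 + s - (y0 - s)) <=
        Rint (fun y => Q (x0 + s) y - Q (x0 - s) y) (y0 - s) (y0 + s).
      rewrite -Rint_cst; last lra.
      apply: le_Rint => //; first exact: cont_on_cst.
      move=> y ? ?; have [|k [k1 _]] := ks (y - y0).
        by rewrite ler_norml; lra.
      rewrite subrKC ler_norml => /andP[].
      have := ler_wpM2l u0 k1; lra.
    apply: le_trans (lerD (ler_norm _) (lexx _)).
    rewrite /rect_int; move: H1 H2.
    have -> : (u / s - 2 * M) * (x0 + s - (x0 - s)) = 2 * u - 4 * M * s.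
      by field; rewrite gt_eqF.
    have -> : (u / s - 2 * M) * (y0 + s - (y0 - s)) = 2 * u - 4 * M * s.
      by field; rewrite gt_eqF.
    lra.
  - rewrite [`|u|]ler0_norm//.
    have H1 : Rint (fun x => P x (y0 - s) - P x (y0 + s)) (x0 - s) (x0 + s) <=
        (u / s + 2 * M) * (x0 + s - (x0 - s)).
      rewrite -Rint_cst; last lra.
      apply: le_Rint => //; first exact: cont_on_cst.
      move=> x ? ?; have [|k [k1 + _]] := ks (x - x0).
        by rewrite ler_norml; lra.
      rewrite subrKC ler_norml => /andP[].
      have := ler_wnM2l u0 k1; lra.
    have H2 : Rint (fun y => Q (x0 + s) y - Q (x0 - s) y) (y0 - s) (y0 + s) <=
        (u / s + 2 * M) * (y0 + s - (y0 - s)).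
      rewrite -Rint_cst; last lra.
      apply: le_Rint => //; first exact: cont_on_cst.
      move=> y ? ?; have [|k [k1 _]] := ks (y - y0).
        by rewrite ler_norml; lra.
      rewrite subrKC ler_norml => /andP[].
      have := ler_wnM2l u0 k1; lra.
    rewrite -normrN; apply: le_trans (lerD (ler_norm _) (lexx _)).
    rewrite /rect_int; move: H1 H2.
    have -> : (u / s + 2 * M) * (x0 + s - (x0 - s)) = 2 * u + 4 * M * s.
      by field; rewrite gt_eqF.
    have -> : (u / s + 2 * M) * (y0 + s - (y0 - s)) = 2 * u + 4 * M * s.
      by field; rewrite gt_eqF.
    lra.
(* Shrinking the square makes the error [8 * M * s] arbitrarily small. *)
apply/ler_addgt0Pr => e ee0.
pose t := Num.min (e / (8 * M)) e0.
have M8 : 0 < 8 * M by rewrite mulr_gt0.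
have t0 : 0 < t by rewrite lt_min e0P divr_gt0.
have te : t <= e0 by rewrite ge_min lexx orbT.
have tM : 8 * M * t <= e by rewrite mulrC -ler_pdivlMr// ge_min lexx.
by apply: le_trans (key t t0 te) _; rewrite lerD2l.
Qed.

(** Every edge is at distance at least [s] from [z], so on the boundary both coefficients of the
    form are at most [|f| / s]; [rect_int_residue] bounds the integral from below. *)
Lemma cauchy_edges s : 0 < s -> a <= x0 - s -> x0 + s <= b ->
  c <= y0 - s -> y0 + s <= d ->
  4 * s * `|complex.Re (f z)| <=
  Rint (fun x => normc (f (Complex x c))) a b +
  Rint (fun x => normc (f (Complex x d))) a b +
  (Rint (fun y => normc (f (Complex a y))) c d +
   Rint (fun y => normc (f (Complex b y))) c d).
Proof.
move=> s0 h1 h2 h3 h4.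
have [ab cd] : a <= b /\ c <= d.
  by split; apply: ltW; [exact: lt_trans xb|exact: lt_trans yd].
have edge x y : s <= `|x - x0| \/ s <= `|y - y0| ->
    `|P x y| <= s^-1 * normc (f (Complex x y)) /\
    `|Q x y| <= s^-1 * normc (f (Complex x y)).
  move=> h; have sn : s <= normc (Complex x y - z).
    case: h => h; apply: le_trans h _.
      exact: (normc_Re (Complex x y - z)).
    exact: (normc_Im (Complex x y - z)).
  have gb : normc (g (Complex x y)) <= s^-1 * normc (f (Complex x y)).
    rewrite Normc.normcM Normc.normcV mulrC ler_wpM2r ?normc_ge0//.
    rewrite lef_pV2 ?posrE//; exact: lt_le_trans sn.
  by split; apply: le_trans gb; [exact: normc_Im|exact: normc_Re].
have Nx y : c <= y -> y <= d -> cont_on (fun x => normc (f (Complex x y))) a b.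
  by move=> cy' yd' x ? ?; apply/cderiv_cont_x/derivable_cderiv; exact: df.
have Ny x : a <= x -> x <= b -> cont_on (fun y => normc (f (Complex x y))) c d.
  by move=> cy' yd' y ? ?; apply/cderiv_cont_y/derivable_cderiv; exact: df.
have ec : s <= `|c - y0| by rewrite distrC ger0_norm; lra.
have ed : s <= `|d - y0| by rewrite ger0_norm; lra.
have ea : s <= `|a - x0| by rewrite distrC ger0_norm; lra.
have eb : s <= `|b - x0| by rewrite ger0_norm; lra.
have H1 : `|Rint (fun x => P x c - P x d) a b| <=
    s^-1 * (Rint (fun x => normc (f (Complex x c))) a b +
            Rint (fun x => normc (f (Complex x d))) a b).
  rewrite -RintD -?RintZ; try by [exact: Nx|apply: cont_onD; exact: Nx].
  apply: norm_Rint_le => //.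
  - by apply: cont_onB; apply: contP => //; rewrite ?(lt_eqF cy) ?(gt_eqF yd).
  - by apply: cont_onZ; apply: cont_onD; exact: Nx.
  move=> x _ _; rewrite mulrDr; apply: le_trans (ler_normB _ _) _.
  by apply: lerD; [have [] := edge x c|have [] := edge x d]; auto.
have H2 : `|Rint (fun y => Q b y - Q a y) c d| <=
    s^-1 * (Rint (fun y => normc (f (Complex a y))) c d +
            Rint (fun y => normc (f (Complex b y))) c d).
  rewrite -RintD -?RintZ; try by [exact: Ny|apply: cont_onD; exact: Ny].
  apply: norm_Rint_le => //.
  - by apply: cont_onB; apply: contQ => //; rewrite ?(lt_eqF ax) ?(gt_eqF xb).
  - by apply: cont_onZ; apply: cont_onD; exact: Ny.
  move=> y _ _; rewrite mulrDr [leRHS]addrC; apply: le_trans (ler_normB _ _) _.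
  by apply: lerD; [have [] := edge b y|have [] := edge a y]; auto.
rewrite mulrAC -ler_pdivlMr// [leRHS]mulrC mulrDr.
apply: le_trans rect_int_residue _.
exact: le_trans (ler_normD _ _) (lerD H1 H2).
Qed.

End CauchyKernel.

(** * Mean value estimate *)

Section Measurability.
Context {R : realType}.

Lemma rat_itvoo_nbhs (x : R) (A : set R) : nbhs x A ->
  exists q1 q2 : rat, ratr q1 < x < ratr q2 /\
    `]ratr q1 : R, ratr q2[%classic `<=` A.
Proof.
move=> [e /= e0 eA].
have [q1] := @rat_in_itvoo R (x - e) x ltac:(by rewrite ltrBlDr ltrDl).
have [q2] := @rat_in_itvoo R x (x + e) ltac:(by rewrite ltrDl).
rewrite !in_itv /= => /andP[h1 h2] /andP[h3 h4].
exists q1, q2; split; first by rewrite h4 h1.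
move=> t /=; rewrite in_itv /= => /andP[t1 t2]; apply: eA.
by rewrite /ball_/= ltr_distlC (lt_trans h3 t1) (lt_trans t2 h2).
Qed.

(** An open set is the union of the countably many boxes with rational end points that it contains,
    and boxes belong to the product sigma-algebra. *)
Lemma open_measurable_prod (U : set (R * R)) : open U -> measurable U.
Proof.
move=> oU.
pose box (q : rat * rat * (rat * rat)) : set (R * R) :=
  `]ratr q.1.1, ratr q.1.2[%classic `*` `]ratr q.2.1, ratr q.2.2[%classic.
have -> : U = \bigcup_q (if `[< box q `<=` U >] then box q else set0).
  apply/seteqP; split=> [[x y] Uxy|p [q _]]; last by case: asboolP => // h /h.
  move: oU; rewrite openE => /(_ _ Uxy)[[A B] /= [Ax By] AB].
  have [p1 [p2 [p12 pA]]] := rat_itvoo_nbhs Ax.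
  have [q1 [q2 [q12 qB]]] := rat_itvoo_nbhs By.
  exists ((p1, p2), (q1, q2)) => //.
  rewrite asboolT; first by split; rewrite /= in_itv.
  by move=> [s t] [/= hs ht]; apply: AB; split => /=; [exact: pA|exact: qB].
apply: countable_bigcupT_measurable; first exact: countableP.
by move=> q; case: asboolP => // _; apply: measurableX.
Qed.

Lemma open_continuous_measurable_prod (D : set (R * R)) (h : R * R -> R) :
  open D -> (forall p, D p -> {for p, continuous h}) -> measurable_fun D h.
Proof.
move=> oD ch; apply: (measurability _ (RGenOInfty.measurableE R)).
move=> _ [_ [x ->] <-]; apply: open_measurable_prod.
rewrite openE => p [Dp /= hp]; rewrite /interior.
rewrite in_itv /= andbT in hp.
near=> q; split.
  by near: q; apply: open_nbhs_nbhs.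
rewrite /= in_itv /= andbT.
by near: q; exact: (cvgr_gt (h p) (ch p Dp)).
Unshelve. all: by end_near. Qed.

End Measurability.

(** * Choice of a level where a line integral is small *)

Section Average.
Context {R : realType}.
Notation mu := (@lebesgue_measure R).

(** Choosing each side of the rectangle at a level where the line integral is below
    average replaces averaging Cauchy's formula over a family of rectangles. *)
Lemma exists_le_average (H : R -> \bar R) (p q I I' : R) : p < q ->
  measurable_fun setT H -> (forall x, 0 <= H x)%E ->
  (\int[mu]_x H x <= I%:E)%E -> I < I' ->
  exists2 c, p <= c <= q & (H c <= (I' / (q - p))%:E)%E.
Proof.
move=> pq mH H0 HI II'; apply: contrapT => /forall2NP K.
have : (I'%:E <= \int[mu]_x H x)%E.
  apply: (@le_trans _ _ (\int[mu]_(x in `[p, q]) H x)%E); last first.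
    by apply: ge0_subset_integral => //.
  apply: (@le_trans _ _ (\int[mu]_(x in `[p, q]) (I' / (q - p))%:E)%E).
    have qp : q - p != 0 by rewrite subr_eq0 gt_eqF.
    by rewrite integral_cst//= (lebesgue_segment (ltW pq)) -EFinM divfK.
  have I'0 : 0 <= I'.
    apply: ltW; apply: le_lt_trans II'; rewrite -lee_fin.
    by apply: le_trans HI; exact: integral_ge0.
  apply: ge0_le_integral => //=.
  - by move=> x _; rewrite lee_fin divr_ge0// subr_ge0 ltW.
  - exact: measurable_funTS.
  - move=> x; rewrite in_itv /= => xpq; have [//|] := K x.
    by move/negP; rewrite -ltNge => /ltW.
by move=> /le_trans /(_ HI); rewrite lee_fin leNgt II'.
Qed.

Lemma EFin_Rint (h : R -> R) a b : cont_on h a b ->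
  (Rint h a b)%:E = (\int[mu]_(x in `[a, b]) (h x)%:E)%E.
Proof.
move=> ch; rewrite /Rint /Rintegral fineK//.
by apply: integrable_fin_num => //; exact: cont_on_integrable.
Qed.

Lemma Rint_subset (h : R -> R) a b a' b' : a' <= a -> b <= b' ->
  (forall x, 0 <= h x) -> cont_on h a' b' -> Rint h a b <= Rint h a' b'.
Proof.
move=> aa bb h0 ch; rewrite -lee_fin !EFin_Rint//; last exact: cont_on_sub ch.
apply: ge0_subset_integral => //=.
- by case/integrableP: (cont_on_integrable ch).
- by move=> x _; rewrite lee_fin.
- by apply: subset_itv; rewrite bnd_simp.
Qed.

End Average.

(** * Bound of the value at the centre of a square by the area integral *)

Section MeanValue.
Context {R : realType}.
Notation mu := (@lebesgue_measure R).
Implicit Types (f : R[i] -> R[i]).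

Definition square (x0 y0 r : R) : set (R * R) :=
  `[x0 - r, x0 + r]%classic `*` `[y0 - r, y0 + r]%classic.

Lemma open_upper_half_plane_R2 : open (@upper_half_plane_R2 R).
Proof.
rewrite openE => -[x y] /= y0; exists (setT, `]0, +oo[%classic).
  split => /=; first exact: filterT.
  apply: open_nbhs_nbhs; split; first exact: interval_open.
  by rewrite /= in_itv /= andbT.
by move=> [s t] [_ /=]; rewrite in_itv /= andbT.
Qed.

Lemma holomorphic_normc_measurable f :
  holomorphic_on (@upper_half_plane R) f ->
  measurable_fun (@upper_half_plane_R2 R)
    (fun p => normc (f (Complex p.1 p.2))).
Proof.
move=> hf; apply: open_continuous_measurable_prod.
  exact: open_upper_half_plane_R2.
by move=> [x y] /= y0; apply/cderiv_continuous/derivable_cderiv; exact: hf.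
Qed.

Lemma square_sub x0 y0 r : r < y0 ->
  square x0 y0 r `<=` @upper_half_plane_R2 R.
Proof.
move=> ry [x y] [_ /=]; rewrite in_itv /= => /andP[h _].
by apply: lt_le_trans h; rewrite subr_gt0.
Qed.

(** Each side is placed at a distance between [r / 2] and [r] from the centre, where by Tonelli some
    line integral is at most [I' / (r / 2)]. With [s = r / 2] in [cauchy_edges] this reads
    [2 * r * |Re f| <= 8 * I' / r]. *)
Lemma mean_value_Re f (x0 y0 r I : R) :
  holomorphic_on (@upper_half_plane R) f -> 0 < r -> r < y0 ->
  (\int[mu \x mu]_(p in square x0 y0 r) (normc (f (Complex p.1 p.2)))%:E
     <= I%:E)%E ->
  r ^+ 2 * `|complex.Re (f (Complex x0 y0))| <= 4 * I.
Proof.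
move=> hf r0 ry HI.
pose N x y := normc (f (Complex x y)).
have N0 x y : 0 <= N x y by exact: normc_ge0.
have df x y : y0 - r <= y -> derivable (f : R[i]^o -> R[i]^o) (Complex x y) 1.
  move=> h; apply: hf; rewrite /upper_half_plane/=.
  by apply: lt_le_trans h; rewrite subr_gt0.
pose G : R * R -> \bar R := (fun p => (N p.1 p.2)%:E) \_ (square x0 y0 r).
have msq : measurable (square x0 y0 r) by exact: measurableX.
have mN : measurable_fun (square x0 y0 r) (fun p => N p.1 p.2).
  apply: (@measurable_funS _ _ _ _ (@upper_half_plane_R2 R)).
  - by apply: open_measurable_prod; exact: open_upper_half_plane_R2.
  - exact: square_sub.
  - exact: holomorphic_normc_measurable.
have mG : measurable_fun setT G.
  apply/(measurable_restrictT _ msq); apply/measurable_EFinP; exact: mN.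
have G0 p : (0 <= G p)%E by apply: erestrict_ge0 => q _; rewrite lee_fin.
have GI : (\int[mu \x mu]_p G p <= I%:E)%E.
  by move: HI; rewrite integral_mkcond.
pose V x := (\int[mu]_y G (x, y))%E.
pose H y := (\int[mu]_x G (x, y))%E.
have mV : measurable_fun setT V by exact: measurable_fun_fubini_tonelli_F.
have mH : measurable_fun setT H by exact: measurable_fun_fubini_tonelli_G.
have V0 x : (0 <= V x)%E by exact: integral_ge0.
have H0 y : (0 <= H y)%E by exact: integral_ge0.
have VI : (\int[mu]_x V x <= I%:E)%E by rewrite -fubini_tonelli1.
have HI' : (\int[mu]_y H y <= I%:E)%E by rewrite -fubini_tonelli2.
have Nx y : y0 - r <= y -> forall a b, cont_on (N^~ y) a b.
  by move=> h a b x _ _; apply/cderiv_cont_x/derivable_cderiv; exact: df.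
have Ny x c d : y0 - r <= c -> cont_on (N x) c d.
  move=> h y yc _; apply/cderiv_cont_y/derivable_cderiv; apply: df.
  exact: le_trans yc.
have VE x : x0 - r <= x <= x0 + r ->
    V x = (Rint (N x) (y0 - r) (y0 + r))%:E.
  move=> hx; rewrite EFin_Rint; last exact: Ny.
  rewrite [RHS]integral_mkcond; apply: eq_integral => y _; rewrite /G !patchE.
  congr (if _ then _ else _).
  by apply/idP/idP; rewrite !inE /square /= !in_itv/= hx//; case.
have HE y : y0 - r <= y <= y0 + r ->
    H y = (Rint (N^~ y) (x0 - r) (x0 + r))%:E.
  move=> hy; rewrite EFin_Rint; last by apply: Nx; case/andP: hy.
  rewrite [RHS]integral_mkcond; apply: eq_integral => x _; rewrite /G !patchE.
  congr (if _ then _ else _).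
  by apply/idP/idP; rewrite !inE /square /= !in_itv/= hy//; case.
apply/ler_addgt0Pr => e e0.
(* [exists_le_average] asks for a level strictly above the integral; the excess disappears with
   [e]. *)
pose I' := I + e / 4.
have II' : I < I' by rewrite ltrDl divr_gt0.
have rE (t : R) : t - r / 2 - (t - r) = r / 2 by field.
have rE' (t : R) : t + r - (t + r / 2) = r / 2 by field.
have r2 : 0 < r / 2 by rewrite divr_gt0.
have lt1 (t : R) : t - r < t - r / 2 by rewrite -subr_gt0 rE.
have lt2 (t : R) : t + r / 2 < t + r by rewrite -subr_gt0 rE'.
have lt3 (t : R) : t - r / 2 < t by rewrite ltrBlDr ltrDl.
have lt4 (t : R) : t < t + r / 2 by rewrite ltrDl.
have [a /andP[a1 a2] Va] := exists_le_average (lt1 x0) mV V0 VI II'.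
have [b /andP[b1 b2] Vb] := exists_le_average (lt2 x0) mV V0 VI II'.
have [c /andP[c1 c2] Hc] := exists_le_average (lt1 y0) mH H0 HI' II'.
have [d /andP[d1 d2] Hd] := exists_le_average (lt2 y0) mH H0 HI' II'.
have ax : a < x0 by exact: le_lt_trans (lt3 x0).
have xb : x0 < b by exact: lt_le_trans b1.
have cy : c < y0 by exact: le_lt_trans (lt3 y0).
have yd : y0 < d by exact: lt_le_trans d1.
have a3 : a <= x0 + r by apply: ltW; apply: lt_trans ax _; rewrite ltrDl.
have b3 : x0 - r <= b by apply: ltW; apply: lt_trans xb; rewrite ltrBlDr ltrDl.
have c3 : c <= y0 + r by apply: ltW; apply: lt_trans cy _; rewrite ltrDl.
have d3 : y0 - r <= d by apply: ltW; apply: lt_trans yd; rewrite ltrBlDr ltrDl.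
rewrite VE ?a1// rE lee_fin in Va.
rewrite VE ?b3// rE' lee_fin in Vb.
rewrite HE ?c1// rE lee_fin in Hc.
rewrite HE ?d3// rE' lee_fin in Hd.
have := @cauchy_edges R f x0 y0 a b c d _ ax xb cy yd (r / 2) r2 a2 b1 c2 d1.
have E1 := Rint_subset a1 b2 (N0^~ c) (Nx _ c1 _ _).
have E2 := Rint_subset a1 b2 (N0^~ d) (Nx _ d3 _ _).
have E3 := Rint_subset c1 d2 (N0 a) (Ny _ _ _ (lexx _)).
have E4 := Rint_subset c1 d2 (N0 b) (Ny _ _ _ (lexx _)).
move=> /(_ _)/le_trans E.
have {E} : 4 * (r / 2) * `|complex.Re (f (Complex x0 y0))| <=
   (I' / (r / 2) + I' / (r / 2)) + (I' / (r / 2) + I' / (r / 2)).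
  apply: E.
    by move=> x y _ _ cy' _; apply: df; exact: le_trans cy'.
  apply: lerD; apply: lerD; [exact: le_trans Hc|exact: le_trans Hd|
     exact: le_trans Va|exact: le_trans Vb].
have -> : I' / (r / 2) + I' / (r / 2) + (I' / (r / 2) + I' / (r / 2)) =
  (2 / r) * (4 * I').
  by field; rewrite gt_eqF.
have -> : 4 * (r / 2) * `|complex.Re (f (Complex x0 y0))| =
   (2 / r) * (r ^+ 2 * `|complex.Re (f (Complex x0 y0))|).
  by field; rewrite gt_eqF.
rewrite ler_pM2l ?divr_gt0// => /le_trans; apply.
by rewrite /I' mulrDr mulrC [4 * (e / 4)]mulrC divfK// mulrC.
Qed.

(** The imaginary part of [f] is, up to sign, the real part of [i f], which has the same modulus;
    adding the two bounds doubles the constant 4. *)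
Lemma mean_value_normc f (x0 y0 r I : R) :
  holomorphic_on (@upper_half_plane R) f -> 0 < r -> r < y0 ->
  (\int[mu \x mu]_(p in square x0 y0 r) (normc (f (Complex p.1 p.2)))%:E
     <= I%:E)%E ->
  r ^+ 2 * normc (f (Complex x0 y0)) <= 8 * I.
Proof.
move=> hf r0 ry HI.
have H1 := mean_value_Re hf r0 ry HI.
pose f' : R[i] -> R[i] := fun w => Complex 0 1 * f w.
have hf' : holomorphic_on (@upper_half_plane R) f'.
  by move=> w /hf; exact: (@derivable_cstM R[i]).
have nE w : normc (f' w) = normc (f w).
  by rewrite Normc.normcM normc_Complex expr0n add0r expr1n sqrtr1 mul1r.
have H2 : r ^+ 2 * `|complex.Re (f' (Complex x0 y0))| <= 4 * I.
  apply: mean_value_Re => //; under eq_integral do rewrite nE.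
  exact: HI.
have E : `|complex.Re (f' (Complex x0 y0))| = `|complex.Im (f (Complex x0 y0))|.
  by rewrite /f'; case: (f _) => u v /=; rewrite mul0r mul1r sub0r normrN.
rewrite E in H2.
apply: (@le_trans _ _ (4 * I + 4 * I)); last by rewrite -mulrDl -natrD.
apply: le_trans (lerD H1 H2); rewrite -mulrDr ler_wpM2l ?sqr_ge0//.
exact: normc_le.
Qed.

End MeanValue.

(** * Growth functions and modulars *)

Section GrowthFunctions.
Context {R : realType}.
Implicit Types (Phi : R -> R).

Lemma growth_ge0 Phi t : growth_function Phi -> 0 <= t -> 0 <= Phi t.
Proof. by move=> [_ [_ [+ _]]]; exact. Qed.

Lemma growth_le Phi s t : growth_function Phi -> 0 <= s -> s <= t ->
  Phi s <= Phi t.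
Proof. by move=> [_ [+ _]]; exact. Qed.

Lemma growth0 Phi : growth_function Phi -> Phi 0 = 0.
Proof.
move=> gP; have [_ [_ [_ /(_ 0 (lexx _))[t t0 Pt]]]] := gP.
apply/eqP; rewrite eq_le growth_ge0// andbT.
by have := growth_le gP (lexx 0) t0; rewrite Pt.
Qed.

Lemma growth_scale Phi l t : growth_function Phi -> convex_on_nonneg Phi ->
  0 <= l -> l <= 1 -> 0 <= t -> Phi (l * t) <= l * Phi t.
Proof.
move=> gP cP l0 l1 t0; have := cP t 0 l t0 (lexx _) l0 l1.
by rewrite (growth0 gP) !mulr0 !addr0.
Qed.

Lemma growth_div Phi k t : growth_function Phi -> convex_on_nonneg Phi ->
  1 <= k -> 0 <= t -> Phi (t / k) <= Phi t / k.
Proof.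
move=> gP cP k1 t0; rewrite mulrC [leRHS]mulrC; apply: growth_scale => //.
  by rewrite invr_ge0 (le_trans ler01).
by rewrite invf_le1// (lt_le_trans ltr01).
Qed.

(** A zero at [t > 0] would propagate by doubling to every [2 ^ n * t], and by monotonicity [Phi]
    would vanish identically, against surjectivity. *)
Lemma Delta2_gt0 Phi t : growth_function Phi -> Delta2 Phi -> 0 < t -> 0 < Phi t.
Proof.
move=> gP [K K1 HK] t0; rewrite lt_neqAle growth_ge0 ?ltW// andbT eq_sym.
apply/eqP => Pt.
have Pn n : Phi (2 ^+ n * t) = 0.
  elim: n => [|n IH]; first by rewrite expr0 mul1r.
  have n0 m : 0 <= 2 ^+ m * t by rewrite mulr_ge0 ?exprn_ge0// ltW.
  apply/eqP; rewrite eq_le growth_ge0// andbT exprS -mulrA.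
  by apply: le_trans (HK _ _) _ => //; rewrite IH mulr0.
have [_ [_ [_ /(_ 1 ler01)[u u0 Pu]]]] := gP.
have [n nP] := ltr_add_invr (y := 0) (x := t / (u + 1))
  ltac:(by rewrite divr_gt0// ltr_wpDl).
have : Phi u <= Phi (2 ^+ n * t).
  apply: growth_le => //.
  rewrite add0r ltr_pdivlMr ?ltr_wpDl// mulrC ltr_pdivrMr// in nP.
  apply: (@le_trans _ _ (t * n.+1%:R)).
    by apply: ltW; apply: lt_trans nP; rewrite ltrDl.
  by rewrite mulrC ler_wpM2r ?(ltW t0)// -natrX ler_nat ltn_expl.
by rewrite Pu Pn ler10.
Qed.

(** This undoes a dilation of the argument, at the price of the factor [A = C * k ^ q]. *)
Lemma class_U_le Phi (k : R) : growth_function Phi -> class_U Phi -> 1 <= k ->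
  exists2 A : R, 0 < A & forall t, 0 <= t -> Phi t <= A * Phi (t / k).
Proof.
move=> gP [q q1 [[C C0 HC] _]] k1.
have k0 : 0 < k by exact: lt_le_trans k1.
exists (C * k `^ q); first by rewrite mulr_gt0// powR_gt0.
move=> t; rewrite le_eqVlt => /predU1P[<-|t0].
  by rewrite mul0r (growth0 gP) mulr0.
have := HC (t / k) k (divr_gt0 t0 k0) k1.
by rewrite divfK// gt_eqF.
Qed.

Lemma growth_eq_lt Phi s t : growth_function Phi -> convex_on_nonneg Phi ->
  0 <= s -> 0 < Phi s -> s < t -> Phi s < Phi t.
Proof.
move=> gP cP s0 Ps st.
have t0 : 0 < t by exact: le_lt_trans st.
have h : Phi s <= s / t * Phi t.
  have := @growth_scale Phi (s / t) t gP cP.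
  rewrite divfK ?gt_eqF//; apply => //; last exact: ltW.
    by rewrite divr_ge0// ltW.
  by rewrite ler_pdivrMr// mul1r ltW.
have Pt : 0 < Phi t by apply: lt_le_trans (growth_le gP s0 (ltW st)).
apply: le_lt_trans h _; rewrite -[ltRHS]mul1r ltr_pM2r//.
by rewrite ltr_pdivrMr// mul1r.
Qed.

(** A convex growth function may vanish on an initial interval but is strictly increasing where it
    is positive. Hence for [u > 0] there is a single preimage, and the supremum defining [ginv] is
    attained there. *)
Lemma ginvE Phi u : growth_function Phi -> convex_on_nonneg Phi -> 0 < u ->
  [/\ 0 <= ginv Phi u, Phi (ginv Phi u) = u &
      forall t, 0 <= t -> Phi t <= u -> t <= ginv Phi u].
Proof.
move=> gP cP u0; have [_ [_ [_ /(_ u (ltW u0))[t0 t00 Pt0]]]] := gP.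
have ub t : 0 <= t -> Phi t <= u -> t <= t0.
  move=> tge Pt; rewrite leNgt; apply/negP => t0t.
  have := growth_eq_lt gP cP t00 _ t0t.
  by rewrite Pt0 => /(_ u0); rewrite ltNge Pt.
have -> : ginv Phi u = t0; last by [].
apply/eqP; rewrite eq_le; apply/andP; split.
- by apply: ge_sup; [exists t0; rewrite /= Pt0|move=> t /= [h1 h2]; exact: ub].
- apply: sup_upper_bound; last by rewrite /= Pt0.
  by split; [exists t0; rewrite /= Pt0|exists t0 => t /= [h1 h2]; exact: ub].
Qed.

(** Stands in for Jensen's inequality, at the price of a factor 2. *)
Lemma growth_chord Phi m t : growth_function Phi -> convex_on_nonneg Phi ->
  0 < m -> 0 < Phi m -> 0 <= t -> t <= m + m / Phi m * Phi t.
Proof.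
move=> gP cP m0 Pm t0; have [tm|/ltW mt] := leP t m.
  apply: le_trans tm _; rewrite lerDl; apply: mulr_ge0.
    by apply: divr_ge0; exact: ltW.
  exact: growth_ge0.
apply: (@le_trans _ _ (m / Phi m * Phi t)); last by rewrite lerDr ltW.
have tp : 0 < t by exact: lt_le_trans mt.
have h : Phi m <= m / t * Phi t.
  rewrite -[in leLHS](divfK (lt0r_neq0 tp) m).
  apply: growth_scale => //; first by rewrite divr_ge0// ltW.
  by rewrite ler_pdivrMr// mul1r.
rewrite mulrAC ler_pdivlMr// mulrC.
by rewrite mulrAC ler_pdivlMr// in h.
Qed.

(** The hypotheses are symmetric in [s] and [t], so a negative exponent reduces to a positive one by
    exchanging them. This controls the variation of the weight over a square. *)
Lemma powR_doubling (g s t : R) : 0 < s -> 0 < t -> s <= 2 * t -> t <= 2 * s ->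
  s `^ g <= 2 `^ `|g| * t `^ g.
Proof.
move=> s0 t0 st ts.
have sn : s \is Num.nneg by rewrite nnegrE ltW.
have tn : t \is Num.nneg by rewrite nnegrE ltW.
have t2n : 2 * t \is Num.nneg by rewrite nnegrE mulr_ge0// ltW.
have s2n : 2 * s \is Num.nneg by rewrite nnegrE mulr_ge0// ltW.
have [g0|g0] := leP 0 g.
  rewrite ger0_norm// -(@powRM R 2 t g (ler0n _ 2) (ltW t0)).
  exact: ge0_ler_powR.
rewrite ltr0_norm//.
have g0' : 0 <= - g by rewrite oppr_ge0 ltW.
have := ge0_ler_powR g0' tn s2n ts.
rewrite (@powRM R 2 s (- g) (ler0n _ 2) (ltW s0)) => h.
have E (u : R) : u `^ g = (u `^ (- g))^-1 by rewrite -powRN opprK.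
rewrite (E s) (E t) ler_pdivlMr ?powR_gt0// mulrC ler_pdivrMr ?powR_gt0//.
Qed.

End GrowthFunctions.

(** * Modulars, Luxemburg norms and the pointwise estimate *)

Section Modular.
Context {R : realType}.
Notation mu := (@lebesgue_measure R).
Implicit Types (Phi : R -> R) (f : R[i] -> R[i]).
Notation D := (@upper_half_plane_R2 R).

Lemma measurable_upper_half_plane : measurable D.
Proof. by apply: open_measurable_prod; exact: open_upper_half_plane_R2. Qed.

Definition modular_integrand Phi (gamma : R) f (lam : R) (p : R * R) : R :=
  Phi (modc (f (Complex p.1 p.2)) / lam) * p.2 `^ gamma.

Lemma modular_integrand_ge0 Phi gamma f lam p : growth_function Phi -> 0 < lam ->
  0 <= modular_integrand Phi gamma f lam p.
Proof.
move=> gP l0; rewrite mulr_ge0 ?powR_ge0// growth_ge0// divr_ge0//.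
  exact: normc_ge0.
exact: ltW.
Qed.

Lemma growth_normc_measurable Phi f lam : growth_function Phi ->
  holomorphic_on (@upper_half_plane R) f -> 0 < lam ->
  measurable_fun D (fun p => Phi (modc (f (Complex p.1 p.2)) / lam)).
Proof.
move=> gP hf l0.
(* [Phi] is monotone only on the nonnegative half-line; composing with the maximum gives a function
   monotone on all of [R], hence measurable. *)
pose Phi' t := Phi (Num.max t 0).
have mP : measurable_fun setT Phi'.
  apply: nondecreasing_measurable => // s t st; rewrite /Phi'.
  apply: (growth_le gP); first by rewrite le_max lexx orbT.
  by rewrite ge_max !le_max st lexx orbT.
have -> : (fun p => Phi (modc (f (Complex p.1 p.2)) / lam)) =
    Phi' \o (fun p : R * R => modc (f (Complex p.1 p.2)) * lam^-1).
  apply/funext => p; rewrite /= /Phi' max_l//.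
  by rewrite divr_ge0//; [exact: normc_ge0|exact: ltW].
apply: measurableT_comp => //; apply: measurable_funM => //.
exact: holomorphic_normc_measurable.
Qed.

Lemma measurable_modular_integrand Phi gamma f lam : growth_function Phi ->
  holomorphic_on (@upper_half_plane R) f -> 0 < lam ->
  measurable_fun D (modular_integrand Phi gamma f lam).
Proof.
move=> gP hf l0; 
apply: (@measurable_funM _ _ _ D (fun p : R * R =>
   Phi (modc (f (Complex p.1 p.2)) / lam)) (fun p => p.2 `^ gamma)).
  exact: (growth_normc_measurable gP hf l0).
apply: (@measurableT_comp _ _ _ _ _ _ (fun y : R => y `^ gamma)).
  exact: measurable_powR.
exact: measurable_funTS measurable_snd.
Qed.

Lemma orlicz_modularE Phi gamma f lam : orlicz_modular Phi gamma f lam =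
  (\int[mu \x mu]_(p in D) (modular_integrand Phi gamma f lam p)%:E)%E.
Proof. by []. Qed.

Lemma modular_le Phi gamma lam Phi' gamma' lam' f (k : R) :
  growth_function Phi -> growth_function Phi' ->
  holomorphic_on (@upper_half_plane R) f -> 0 < lam -> 0 < lam' -> 0 <= k ->
  (forall p, D p -> modular_integrand Phi gamma f lam p <=
                    k * modular_integrand Phi' gamma' f lam' p) ->
  (orlicz_modular Phi gamma f lam <= k%:E * orlicz_modular Phi' gamma' f lam')%E.
Proof.
move=> gP gP' hf l0 l0' k0 H; rewrite !orlicz_modularE -ge0_integralZl_EFin//=.
- apply: ge0_le_integral => //=.
  + exact: measurable_upper_half_plane.
  + by move=> p _; rewrite lee_fin; exact: modular_integrand_ge0.
  + by apply/measurable_EFinP; exact: measurable_modular_integrand.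
  + apply/measurable_EFinP; apply: measurable_funM => //.
    exact: measurable_modular_integrand.
- exact: measurable_upper_half_plane.
- by move=> p _; rewrite lee_fin; exact: modular_integrand_ge0.
- by apply/measurable_EFinP; exact: measurable_modular_integrand.
Qed.

Lemma modular_nonincreasing Phi gamma f lam lam' : growth_function Phi ->
  holomorphic_on (@upper_half_plane R) f -> 0 < lam -> lam <= lam' ->
  (orlicz_modular Phi gamma f lam' <= orlicz_modular Phi gamma f lam)%E.
Proof.
move=> gP hf l0 ll; rewrite -[leRHS]mul1e.
have l0' : 0 < lam' by exact: lt_le_trans ll.
apply: modular_le => // p _; rewrite mul1r ler_wpM2r ?powR_ge0//.
apply: growth_le => //; first by rewrite divr_ge0 ?normc_ge0// ltW.
by rewrite ler_wpM2l ?normc_ge0// lef_pV2.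
Qed.

(** By convexity and [Phi 0 = 0], dividing the argument by [k >= 1] divides the modular by at least
    [k]. A bound on a modular thus becomes a bound on a Luxemburg norm. *)
Lemma modular_scale Phi gamma f lam (k M : R) : growth_function Phi ->
  convex_on_nonneg Phi ->
  holomorphic_on (@upper_half_plane R) f -> 0 < lam -> 1 <= k -> M <= k ->
  (orlicz_modular Phi gamma f lam <= M%:E)%E ->
  (orlicz_modular Phi gamma f (k * lam) <= 1)%E.
Proof.
move=> gP cP hf l0 k1 Mk HM.
have k0 : 0 < k by exact: lt_le_trans k1.
apply: (@le_trans _ _ (k^-1%:E * orlicz_modular Phi gamma f lam)%E).
  apply: modular_le => //; [exact: mulr_gt0|by rewrite invr_ge0 ltW|].
  move=> p _; rewrite mulrA ler_wpM2r ?powR_ge0//.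
  rewrite invfM [k^-1 * lam^-1]mulrC mulrA [leRHS]mulrC.
  apply: growth_div => //.
  by rewrite mulr_ge0 ?normc_ge0// invr_ge0 ltW.
apply: (@le_trans _ _ (k^-1%:E * k%:E)%E).
  by rewrite lee_wpmul2l ?lee_fin ?invr_ge0 ?(ltW k0)// (le_trans HM)// lee_fin.
by rewrite -EFinM mulVf// gt_eqF.
Qed.

(** The witness excludes the empty set, whose infimum is 0 by convention. The strict inequality
    provides an admissible [l' < lam] without the infimum having to be attained. *)
Lemma modular_lt_lux Phi gamma f lam : growth_function Phi ->
  holomorphic_on (@upper_half_plane R) f ->
  (exists2 l : R, 0 < l & (orlicz_modular Phi gamma f l <= 1)%E) ->
  lux_norm Phi gamma f < lam -> (orlicz_modular Phi gamma f lam <= 1)%E.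
Proof.
move=> gP hf [l l0 Hl] /inf_lt[|l' /= [l'0 Hl'] l'lam]; first by exists l.
by apply: le_trans Hl'; apply: modular_nonincreasing => //; exact: ltW.
Qed.

Lemma lux_norm_le Phi gamma f lam : 0 < lam ->
  (orlicz_modular Phi gamma f lam <= 1)%E -> lux_norm Phi gamma f <= lam.
Proof.
by move=> l0 H; apply: ge_inf => //; exists 0 => l /= [/ltW].
Qed.

Lemma lux_set_nonempty Phi gamma f : growth_function Phi ->
  convex_on_nonneg Phi -> in_bergman_orlicz Phi gamma f ->
  exists2 l : R, 0 < l & (orlicz_modular Phi gamma f l <= 1)%E.
Proof.
move=> gP cP [hf Hf].
have H0 : (0 <= orlicz_modular Phi gamma f 1)%E.
  rewrite orlicz_modularE; apply: integral_ge0 => p _; rewrite lee_fin.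
  exact: modular_integrand_ge0.
set M := fine (orlicz_modular Phi gamma f 1).
exists (Num.max 1 M * 1); first by rewrite mulr1 lt_max ltr01.
apply: (@modular_scale _ _ _ _ _ M) => //; rewrite ?le_max ?lexx ?orbT//.
by rewrite /M fineK// ge0_fin_numE.
Qed.

Lemma square_area x0 y0 (r : R) : 0 <= r ->
  ((mu \x mu) (square x0 y0 r) = (4 * r ^+ 2)%:E)%E.
Proof.
move=> r0.
have e (t : R) : t - r <= t + r by rewrite lerD2l ge0_cp.
have E (t : R) : mu `[t - r, t + r]%classic = (2 * r)%:E.
  by have := lebesgue_segment (e t) => ->; congr EFin; ring.
transitivity (mu `[(x0 - r)%R, (x0 + r)%R]%classic *
  mu `[(y0 - r)%R, (y0 + r)%R]%classic)%E.
  exact: product_measure1E.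
by rewrite !E -EFinM; congr EFin; ring.
Qed.

(** With [m] a fixed fraction of [|f z| / lam], the chord inequality bounds [|f| / lam] by [m] plus
    a multiple of [Phi (|f| / lam)]. Over the square of half-side [y / 2] the integral of the second
    term is controlled by the modular, since there the weight is comparable to [y ^ gamma]. *)
Lemma pointwise_estimate (gamma : R) : exists2 K : R, 1 <= K &
  forall Phi f lam x y, growth_function Phi -> convex_on_nonneg Phi ->
  holomorphic_on (@upper_half_plane R) f -> 0 < lam ->
  (orlicz_modular Phi gamma f lam <= 1)%E -> 0 < y ->
  Phi (modc (f (Complex x y)) / (K * lam)) * y `^ (2 + gamma) <= 1.
Proof.
pose C : R := 2 `^ `|gamma|.
have C1 : 1 <= C by rewrite -(powRr0 2); apply: ler_powR; rewrite ?ler1n.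
have C0 : 0 < C by exact: lt_le_trans C1.
exists (64 * C); first by rewrite -[leLHS]mul1r ler_pM// ler1n.
move=> Phi f lam x y gP cP hf l0 HM y0.
set z := Complex x y; pose A := modc (f z) / lam.
have A0 : 0 <= A by rewrite divr_ge0// ?normc_ge0// ltW.
(* The constant term [m] has integral [4 * m * r ^ 2], hence enters the mean value estimate as
   [32 * m * r ^ 2]; 64 is twice 32, so half of the left-hand side survives. *)
pose m := A / 64.
have m0 : 0 <= m by rewrite divr_ge0.
have -> : modc (f z) / (64 * C * lam) = m / C.
  by rewrite /m /A; field; rewrite !gt_eqF.
have yg0 : 0 < y `^ gamma by rewrite powR_gt0.
have -> : y `^ (2 + gamma) = y ^+ 2 * y `^ gamma.
  by rewrite -(powR_mulrn 2 (ltW y0)) powRD// (gt_eqF y0) implybT.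
(* The chord inequality divides by [Phi m]; when this is 0 the estimate is trivial. *)
have [Pm|Pm] := leP (Phi m) 0.
  have -> : Phi (m / C) = 0.
    have mC : 0 <= m / C by rewrite divr_ge0// ltW.
    apply/eqP; rewrite eq_le (growth_ge0 gP mC) andbT.
    apply: le_trans (growth_div gP cP C1 m0) _.
    by rewrite ler_pdivrMr// mul0r.
  by rewrite mul0r ler01.
have mp : 0 < m.
  rewrite lt_neqAle m0 andbT; apply/eqP => m00; move: Pm.
  by rewrite -m00 (growth0 gP) ltxx.
suff H : Phi m * (y ^+ 2 * y `^ gamma) <= C.
  apply: (@le_trans _ _ (Phi m / C * (y ^+ 2 * y `^ gamma))).
    by rewrite ler_wpM2r ?growth_div// mulr_ge0 ?sqr_ge0// ltW.
  by rewrite mulrAC ler_pdivrMr// mul1r.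
pose r := y / 2.
have r0 : 0 < r by rewrite divr_gt0.
have ry : r < y by rewrite ltr_pdivrMr// mulr_natr mulr2n ltrDl.
(* The slope [m / Phi m] of the chord, times the factor that inserts the weight:
   [1 <= C / y ^ gamma * p.2 ^ gamma] for [p] in the square. *)
pose kap := lam * (m / Phi m * (C / y `^ gamma)).
have kap0 : 0 <= kap.
  by apply/ltW/mulr_gt0 => //; apply: mulr_gt0; exact: divr_gt0.
pose I := lam * m * (4 * r ^+ 2) + kap.
have lm0 : 0 <= lam * m by rewrite mulr_ge0// ltW.
have msq : measurable (square x y r) by exact: measurableX.
have sD := square_sub (x0 := x) ry.
have mI : measurable_fun (square x y r)
    (fun p => (modular_integrand Phi gamma f lam p)%:E).
  apply/measurable_EFinP; apply: measurable_funS sD _.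
    exact: measurable_upper_half_plane.
  exact: measurable_modular_integrand.
have HI : (\int[mu \x mu]_(p in square x y r) (normc (f (Complex p.1 p.2)))%:E
     <= I%:E)%E.
  apply: (@le_trans _ _ (\int[mu \x mu]_(p in square x y r)
      ((lam * m)%:E + kap%:E * (modular_integrand Phi gamma f lam p)%:E))%E).
    apply: ge0_le_integral => //=.
    - by move=> p _; rewrite lee_fin normc_ge0.
    - apply/measurable_EFinP; apply: measurable_funS sD _.
        exact: measurable_upper_half_plane.
      exact: holomorphic_normc_measurable.
    - apply: emeasurable_funD => //.
      by apply: emeasurable_funM => //; exact: measurable_cst.
    move=> p [_ /=]; rewrite in_itv /= => /andP[p1 p2].
    rewrite -EFinM -EFinD lee_fin /kap -(mulrA lam) -(mulrDr lam).
    rewrite -ler_pdivrMl// mulrC.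
    have p0 : 0 < p.2 by apply: lt_le_trans p1; rewrite subr_gt0.
    have g0 : 0 <= normc (f (Complex p.1 p.2)) / lam.
      by rewrite divr_ge0 ?normc_ge0// ltW.
    apply: le_trans (growth_chord gP cP mp Pm g0) _.
    rewrite lerD2l -[leRHS]mulrA; apply: ler_wpM2l.
      by apply: divr_ge0; exact: ltW.
    rewrite /modular_integrand mulrCA -[leLHS]mulr1.
    apply: ler_wpM2l; first exact: (growth_ge0 gP g0).
    rewrite mulrAC ler_pdivlMr// mul1r; apply: powR_doubling => //.
      by rewrite -ler_pdivrMl// mulrC; apply: le_trans p1; rewrite /r lerBrDr -splitr.
    apply: le_trans p2 _; rewrite mulr_natl mulr2n lerD2l.
    exact: ltW.
  rewrite ge0_integralD//=; last 2 first.
  - by move=> p _; rewrite -EFinM lee_fin mulr_ge0// modular_integrand_ge0.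
  - by apply: emeasurable_funM => //; exact: measurable_cst.
  rewrite integral_cst//= (square_area _ _ (ltW r0)) -EFinM /I [leRHS]EFinD.
  apply: leeD2l; rewrite ge0_integralZl_EFin//; last first.
    by move=> p _; rewrite lee_fin modular_integrand_ge0.
  rewrite -[leRHS]mule1 lee_wpmul2l ?lee_fin//.
  apply: le_trans HM; apply: ge0_subset_integral => //.
  - exact: measurable_upper_half_plane.
  - by apply/measurable_EFinP; exact: measurable_modular_integrand.
  - by move=> p _; rewrite lee_fin modular_integrand_ge0.
have := mean_value_normc hf r0 ry HI.
have -> : normc (f (Complex x y)) = lam * (64 * m).
  by rewrite /m /A -/(modc _) -/z; field; rewrite !gt_eqF.
have -> : 8 * I = lam * (32 * m * r ^+ 2 + 8 * (m / Phi m * (C / y `^ gamma))).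
  by rewrite /I /kap; ring.
rewrite mulrCA ler_pM2l// -lerBlDl.
have -> : r ^+ 2 * (64 * m) - 32 * m * r ^+ 2 = 8 * (m * y ^+ 2).
  by rewrite /r; field.
rewrite ler_pM2l// -mulrA ler_pM2l// => h.
by rewrite mulrA -ler_pdivlMr// mulrC -ler_pdivlMr// [leRHS]mulrC.
Qed.

End Modular.

(** * Sufficiency *)

Section Sufficiency.
Context {R : realType} (Phi1 Phi2 : R -> R) (alpha beta : R).
Hypotheses (g1 : growth_function Phi1) (c1 : convex_on_nonneg Phi1)
  (g2 : growth_function Phi2) (c2 : convex_on_nonneg Phi2)
  (u2 : class_U Phi2) (d1 : Delta2 Phi1).
Hypothesis ratio : forall s t : R, 0 < s -> s <= t ->
  Phi2 s / Phi1 s <= Phi2 t / Phi1 t.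

Lemma modular_transfer (C K : R) f lam : 0 < C -> 1 <= K -> 0 < lam ->
  (forall t : R, 0 < t ->
     ginv Phi1 (t `^ (2 + alpha)) <= ginv Phi2 (C * t `^ (2 + beta))) ->
  holomorphic_on (@upper_half_plane R) f ->
  (forall x y : R, 0 < y ->
    Phi1 (modc (f (Complex x y)) / (K * lam)) * y `^ (2 + alpha) <= 1) ->
  (orlicz_modular Phi2 beta f (K * lam) <=
     C%:E * orlicz_modular Phi1 alpha f lam)%E.
Proof.
move=> C0 K1 l0 HC hf pw.
have K0 : 0 < K by exact: lt_le_trans K1.
have Kl0 : 0 < K * lam by exact: mulr_gt0.
apply: modular_le => //; first exact: ltW.
move=> [x y] /= y0; rewrite /modular_integrand/=.
set u := modc _ / (K * lam).
have n0 : 0 <= modc (f (Complex x y)) by exact: normc_ge0.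
have u0 : 0 <= u by rewrite divr_ge0// ltW.
have uu : u <= modc (f (Complex x y)) / lam.
  by rewrite ler_wpM2l// lef_pV2 ?posrE// ler_peMl// ltW.
have pu : Phi1 u <= Phi1 (modc (f (Complex x y)) / lam) by exact: growth_le.
have ya0 : 0 < y `^ alpha by exact: powR_gt0.
have yb0 : 0 < y `^ beta by exact: powR_gt0.
suff : Phi2 u * y `^ beta <= C * (Phi1 u * y `^ alpha).
  by move=> /le_trans; apply; rewrite ler_wpM2l ?(ltW C0)// ler_wpM2r ?powR_ge0.
(* The hypothesis on the ratio concerns positive arguments only; at 0 both sides vanish. *)
have [up|up] : 0 < u \/ u = 0.
- by move: u0; rewrite le_eqVlt => /predU1P[->|]; [right|left].
- pose t := y^-1.
  have t0 : 0 < t by rewrite invr_gt0.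
  have ta0 : 0 < t `^ (2 + alpha) by exact: powR_gt0.
  have Ctb0 : 0 < C * t `^ (2 + beta) by rewrite mulr_gt0// powR_gt0.
  have [s0 Ps smax] := ginvE g1 c1 ta0.
  set s := ginv Phi1 _ in s0 Ps smax.
  have [s0' Ps' _] := ginvE g2 c2 Ctb0.
  (* The value does not depend on [g], which is what trades the exponent [beta] for [alpha]
     below. *)
  have tyE (g : R) : t `^ (2 + g) * y `^ g = t ^+ 2.
    rewrite powRD ?(gt_eqF t0) ?implybT// (powR_mulrn 2 (ltW t0)) -mulrA.
    by rewrite -powRM ?(ltW t0) ?(ltW y0)// /t mulVf ?gt_eqF// powR1 mulr1.
  have us : u <= s.
    apply: smax => //; have := pw x y y0; rewrite -/u -ler_pdivlMr ?powR_gt0//.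
    by rewrite div1r /t -powR_inv1 ?(ltW y0)// -powRrM mulN1r powRN.
  have s2 : Phi2 s <= C * t `^ (2 + beta).
    by rewrite -Ps'; apply: growth_le => //; exact: HC.
  have p1 : 0 < Phi1 u by exact: Delta2_gt0.
  have p1s : 0 < Phi1 s by rewrite Ps.
  have := ratio up us.
  rewrite ler_pdivrMr// mulrAC => h.
  apply: (@le_trans _ _ (C * t `^ (2 + beta) * Phi1 u / Phi1 s * y `^ beta)).
    rewrite ler_wpM2r ?(ltW yb0)//; apply: le_trans h _.
    by rewrite ler_wpM2r ?invr_ge0 ?(ltW p1s)// ler_wpM2r// ltW.
  rewrite Ps.
  have -> : C * t `^ (2 + beta) * Phi1 u / t `^ (2 + alpha) * y `^ beta =
     C * Phi1 u * (t `^ (2 + beta) * y `^ beta) / t `^ (2 + alpha) by ring.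
  rewrite tyE -(tyE alpha).
  have -> : C * Phi1 u * (t `^ (2 + alpha) * y `^ alpha) / t `^ (2 + alpha) =
     C * (Phi1 u * y `^ alpha) by field; rewrite gt_eqF.
  by [].
by rewrite up (growth0 g1) (growth0 g2) !mul0r mulr0.
Qed.

Lemma embedding_of_ginv_le (C : R) : 0 < C ->
  (forall t : R, 0 < t ->
     ginv Phi1 (t `^ (2 + alpha)) <= ginv Phi2 (C * t `^ (2 + beta))) ->
  continuous_embedding Phi1 alpha Phi2 beta.
Proof.
move=> C0 HC; have [K K1 HK] := @pointwise_estimate R alpha.
(* [modular_scale] requires a dilation factor at least 1. *)
pose C1 := Num.max 1 C.
have C11 : 1 <= C1 by rewrite le_max lexx.
have C1C : C <= C1 by rewrite le_max lexx orbT.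
have K0 : 0 < K by exact: lt_le_trans K1.
have C10 : 0 < C1 by exact: lt_le_trans C11.
have key f lam : holomorphic_on (@upper_half_plane R) f -> 0 < lam ->
    (orlicz_modular Phi1 alpha f lam <= 1)%E ->
    (orlicz_modular Phi2 beta f (C1 * (K * lam)) <= 1)%E.
  move=> hf l0 Hl; apply: (@modular_scale _ _ _ _ _ _ C) => //.
    exact: mulr_gt0.
  apply: le_trans (modular_transfer C0 K1 l0 HC hf _) _.
    by move=> x y y0; exact: (HK Phi1 f lam x y g1 c1 hf l0 Hl y0).
  by rewrite -[leRHS]mule1 lee_wpmul2l// lee_fin ltW.
exists (C1 * K); first exact: mulr_gt0.
move=> f Hf; have [hf _] := Hf.
have [l0 l00 Hl0] := lux_set_nonempty g1 c1 Hf.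
split; [split => //|].
(* Membership asks for a finite modular at scale 1, while [key] controls it at the scale
   [C1 * (K * l0)]; the upper type of [Phi2] bridges the two. *)
- pose L := Num.max 1 (C1 * (K * l0)).
  have L1 : 1 <= L by rewrite le_max lexx.
  have L0 : 0 < L by exact: lt_le_trans L1.
  have [A A0 HA] := class_U_le g2 u2 L1.
  apply: (@le_lt_trans _ _ (A%:E * orlicz_modular Phi2 beta f L)%E).
    apply: modular_le => //; first exact: ltW.
    move=> p _; rewrite /modular_integrand mulrA ler_wpM2r ?powR_ge0//.
    by rewrite divr1; apply: HA; exact: normc_ge0.
  apply: (@le_lt_trans _ _ (A%:E * 1)%E); last by rewrite mule1 ltry.
  apply: lee_wpmul2l; first by rewrite lee_fin ltW.
  apply: le_trans (key _ _ hf l00 Hl0).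
  apply: modular_nonincreasing => //; last by rewrite le_max lexx orbT.
  by rewrite !mulr_gt0.
- rewrite mulrC -ler_pdivrMr ?mulr_gt0//.
  apply: lb_le_inf; first by exists l0.
  move=> l [/= lp Hl]; rewrite ler_pdivrMr ?mulr_gt0// mulrC -mulrA.
  by apply: lux_norm_le; [rewrite !mulr_gt0|exact: key].
Qed.

End Sufficiency.

(** * Necessity *)

Section KernelIntegral.
Context {R : realType}.
Notation mu := (@lebesgue_measure R).

(** The weight [y ^ g] against a decay of order [g + 2], the exponent for which an elementary
    primitive exists. *)
Definition halfline_kernel (g c y : R) : R := y `^ g * (y + c) `^ (- (g + 2)).

Lemma halfline_kernel_ge0 g c y : 0 <= halfline_kernel g c y.
Proof. by rewrite mulr_ge0// powR_ge0. Qed.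

Lemma measurable_halfline_kernel g c : measurable_fun setT (halfline_kernel g c).
Proof.
apply: measurable_funM; first exact: measurable_powR.
apply: (@measurableT_comp _ _ _ _ _ _ (fun y : R => y `^ (- (g + 2)))).
  exact: measurable_powR.
exact: measurable_funD.
Qed.

Let prim (g c y : R) := ((g + 1) * c)^-1 * expR ((g + 1) * (ln y - ln (y + c))).

Let prim_derive (g c y : R) : -1 < g -> 0 < c -> 0 < y ->
  is_derive y 1 (prim g c) (halfline_kernel g c y).
Proof.
move=> g1 c0 y0; have yc0 : 0 < y + c by rewrite addr_gt0.
have d1 := is_derive1_ln y0.
have d2 : is_derive y 1 (fun t => ln (t + c)) (y + c)^-1.
  have d3 : is_derive y 1 (fun t : R => t + c) 1.
    by apply: is_derive_eq; rewrite addr0.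
  have d4 := is_derive1_ln yc0.
  have := @is_derive1_comp R (@ln R) (fun t => t + c) y _ _ d4 d3.
  by rewrite mulr1.
pose E (t : R) := (g + 1) * (ln t - ln (t + c)).
have d5 : is_derive y 1 E ((g + 1) * (y^-1 - (y + c)^-1)).
  by apply: is_derive_eq.
have d6 := @is_derive1_comp R (@expR R) E y _ _ (is_derive_expR _) d5.
have d7 : is_derive y 1 (prim g c)
    (((g + 1) * c)^-1 * (expR (E y) * ((g + 1) * (y^-1 - (y + c)^-1)))).
  exact: (@is_deriveZ R R R (expR \o E) ((g + 1) * c)^-1 y 1 _ d6).
apply: is_derive_eq.
have gc0 : g + 1 != 0 by rewrite gt_eqF// -ltrBlDr sub0r.
rewrite /halfline_kernel /powR !gt_eqF// /E -expRD.
have -> : y^-1 = expR (- ln y) by rewrite expRN lnK.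
have -> : (y + c)^-1 = expR (- ln (y + c)) by rewrite expRN lnK.
have -> : expR (- ln y) - expR (- ln (y + c)) =
    c * expR (- ln y - ln (y + c)).
  rewrite expRD !expRN !lnK//; field.
  by rewrite !gt_eqF.
have -> : ((g + 1) * c)^-1 * (expR ((g + 1) * (ln y - ln (y + c))) *
   ((g + 1) * (c * expR (- ln y - ln (y + c))))) =
   expR ((g + 1) * (ln y - ln (y + c))) * expR (- ln y - ln (y + c)).
  by field; rewrite gc0 gt_eqF.
by rewrite -expRD; congr expR; ring.
Qed.

Let prim_ge0 g c y : -1 < g -> 0 < c -> 0 <= prim g c y.
Proof.
move=> g1 c0; rewrite /prim mulr_ge0 ?expR_ge0// invr_ge0 mulr_ge0//; last exact: ltW.
by rewrite ltW// -ltrBlDr sub0r.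
Qed.

Let prim_cvg (g c : R) : -1 < g -> 0 < c ->
  prim g c y @[y --> +oo] --> ((g + 1) * c)^-1.
Proof.
move=> g1 c0; rewrite -[X in _ --> X]mulr1; apply: cvgMl_tmp.
have E1 : (y / (y + c) @[y --> +oo] --> (1 : R)).
  apply/cvgrPdist_lt => e e0; near=> y.
  have y0 : 0 < y by near: y; apply: nbhs_pinfty_gt; exact: num_real.
  have ye : c / e < y by near: y; apply: nbhs_pinfty_gt; exact: num_real.
  have yc0 : 0 < y + c by rewrite addr_gt0.
  have -> : 1 - y / (y + c) = c / (y + c) by field; rewrite gt_eqF.
  rewrite ger0_norm ?divr_ge0 ?(ltW c0) ?(ltW yc0)//.
  rewrite ltr_pdivrMr// mulrC -ltr_pdivrMr//; apply: lt_trans ye _.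
  by rewrite ltrDl.
have E2 : (expR ((g + 1) * ln (y / (y + c))) @[y --> +oo] --> (1 : R)).
  rewrite -{2}expR0 -(mulr0 (g + 1)) -ln1.
  apply: (@continuous_cvg _ _ _ _ _ _ (@expR R)); first exact: continuous_expR.
  apply: cvgMl_tmp.
  by apply: (@continuous_cvg _ _ _ _ _ _ (@ln R)) => //; exact: continuous_ln.
apply: cvg_trans E2; apply: near_eq_cvg; near=> y.
have y0 : 0 < y by near: y; apply: nbhs_pinfty_gt; exact: num_real.
by rewrite ln_div// posrE addr_gt0.
Unshelve. all: by end_near. Qed.

(** The primitive is [(y / (y + c)) ^ (g + 1) / ((g + 1) * c)]. *)
Lemma integral_halfline_kernel (g c : R) : -1 < g -> 0 < c ->
  (\int[mu]_(y in `]0%R, +oo[) (halfline_kernel g c y)%:E <=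
    (((g + 1) * c)^-1)%:E)%E.
Proof.
(* The kernel may be singular at 0 when [g < 0], so the fundamental theorem is applied on [[a n,
   +oo[] and [n] tends to infinity. The primitive at [a n] is nonnegative and is dropped. *)
move=> g1 c0; pose a n : R := n.+1%:R^-1.
have a0 n : 0 < a n by rewrite invr_gt0.
have E : `]0, +oo[%classic = \bigcup_n (`[a n, +oo[%classic : set R).
  apply/seteqP; split=> [x /=|x [n _] /=]; rewrite !in_itv/= !andbT; last first.
    exact: lt_le_trans.
  move=> x0; have [n nP] := ltr_add_invr (y := 0) (x := x) x0.
  by exists n => //=; rewrite in_itv/= andbT ltW// -[ltLHS]add0r.
have mk A : measurable A -> measurable_fun A (EFin \o halfline_kernel g c).
  move=> mA; apply/measurable_EFinP; apply: measurable_funTS.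
  exact: measurable_halfline_kernel.
have cv : (\int[mu]_(y in `[a n, +oo[) (halfline_kernel g c y)%:E @[n --> \oo] -->
    \int[mu]_(y in \bigcup_n (`[a n, +oo[%classic : set R))
      (halfline_kernel g c y)%:E)%E.
  apply: ge0_nondecreasing_set_cvg_integral => //.
  - apply/nondecreasing_seqP => n; rewrite subsetEset => x /=.
    rewrite !in_itv/= !andbT; apply: le_trans.
    by rewrite lef_pV2 ?posrE// ler_nat.
  - by move=> n; apply: mk.
  - by move=> n x _; rewrite lee_fin halfline_kernel_ge0.
rewrite E -(cvg_lim _ cv)//; apply: lime_le; first exact: cvgP cv.
near=> n.
have dp y : a n <= y -> is_derive y 1 (prim g c) (halfline_kernel g c y).
  by move=> ay; apply: prim_derive => //; exact: lt_le_trans ay.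
rewrite (@ge0_continuous_FTC2y _ _ (prim g c) (a n) ((g + 1) * c)^-1).
- by rewrite leeBlDr// leeDl// lee_fin prim_ge0.
- by move=> x _; exact: halfline_kernel_ge0.
- apply: continuous_in_subspaceT => x; rewrite inE /= in_itv/= andbT => ax.
  have x0 : 0 < x by exact: lt_le_trans ax.
  have xc0 : 0 < x + c by rewrite addr_gt0.
  apply: (@continuousM _ _ (fun y => y `^ g) (fun y => (y + c) `^ (- (g + 2)))).
    apply/differentiable_continuous/derivable1_diffP/derivable_powR.
    by rewrite in_itv/= andbT.
  apply: (@continuous_comp _ _ _ (fun t => t + c) (fun t => t `^ (- (g + 2)))).
    by apply: continuousD => //; exact: cst_continuous.
  apply/differentiable_continuous/derivable1_diffP/derivable_powR.
  by rewrite in_itv/= andbT.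
- exact: prim_cvg.
- by move=> x ax; have [] := dp x (ltW ax).
- apply: cvg_at_right_filter.
  apply/differentiable_continuous/derivable1_diffP.
  by have [] := dp _ (lexx (a n)).
- move=> x; rewrite in_itv/= andbT => ax.
  by rewrite derive1E; have [_ ->] := dp x (ltW ax).
Unshelve. all: by end_near. Qed.

(** By symmetry this is twice the half-line integral with [g = 0]. *)
Lemma integral_even_kernel (c : R) : 0 < c ->
  (\int[mu]_x ((`|x| + c) `^ (- 2))%:E <= (2 * c^-1)%:E)%E.
Proof.
move=> c0; rewrite ge0_symfun_integralT; first last.
- by move=> x /=; rewrite normrN.
- move=> x; have xc0 : 0 < `|x| + c by rewrite ltr_wpDl.
  apply: (@continuous_comp _ _ _ (fun t => `|t| + c) (fun t => t `^ (- 2))).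
    by apply: continuousD; [exact: norm_continuous|exact: cst_continuous].
  apply/differentiable_continuous/derivable1_diffP/derivable_powR.
  by rewrite in_itv/= andbT.
- by move=> x; exact: powR_ge0.
rewrite EFinM lee_wpmul2l ?lee_fin//.
have := @integral_halfline_kernel 0 c _ c0.
rewrite add0r mul1r => /(_ ltac:(by rewrite ltrN10)).
apply: le_trans; rewrite -set_itvcy -integral_itv_obnd_cbnd; last first.
  apply/measurable_EFinP; apply: measurable_funTS.
  apply: (@measurableT_comp _ _ _ _ _ _ (fun y : R => y `^ (- 2))).
    exact: measurable_powR.
  by apply: measurable_funD => //; exact: measurable_normr.
rewrite le_eqVlt; apply/orP; left; apply/eqP; apply: eq_integral => x.
rewrite inE /= in_itv/= andbT => x0.
by rewrite /halfline_kernel powRr0 mul1r add0r gtr0_norm.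
Qed.

Lemma integral_prod_le (u v : R -> R) (a b : R) :
  measurable_fun setT u -> measurable_fun setT v ->
  (forall x, 0 <= u x) -> (forall x, 0 <= v x) -> 0 <= b ->
  (\int[mu]_x (u x)%:E <= a%:E)%E ->
  (\int[mu]_(y in `]0%R, +oo[) (v y)%:E <= b%:E)%E ->
  (\int[mu \x mu]_(p in @upper_half_plane_R2 R) (u p.1 * v p.2)%:E
     <= (a * b)%:E)%E.
Proof.
move=> mu' mv u0 v0 b0 Hu Hv.
(* Extension by zero turns the integral over the half-plane into one over the whole plane. *)
pose v' := v \_ `]0, +oo[.
have mv' : measurable_fun setT v'.
  apply/(measurable_restrictT v (measurable_itv _)); exact: measurable_funTS.
have v'0 x : 0 <= v' x by rewrite /v' patchE; case: ifP.
pose h (p : R * R) := (u p.1 * v' p.2)%:E.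
have mh : measurable_fun setT h.
  apply/measurable_EFinP; apply: measurable_funM.
    exact: (measurableT_comp mu' measurable_fst).
  exact: (measurableT_comp mv' measurable_snd).
have h0 p : (0 <= h p)%E by rewrite lee_fin mulr_ge0.
apply: (@le_trans _ _ (\int[mu \x mu]_(p in @upper_half_plane_R2 R) h p)%E).
  rewrite le_eqVlt; apply/orP; left; apply/eqP; apply: eq_integral => p.
  rewrite inE /= => p0; rewrite /h /v' patchE mem_set//=.
  by rewrite in_itv/= andbT.
apply: (@le_trans _ _ (\int[mu \x mu]_p h p)%E).
  apply: ge0_subset_integral => //.
  by apply: open_measurable_prod; exact: open_upper_half_plane_R2.
rewrite fubini_tonelli1//.
have Fv : (\int[mu]_y (v' y)%:E <= b%:E)%E.
  apply: le_trans Hv; rewrite [leRHS]integral_mkcond.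
  by under [leRHS]eq_integral do rewrite restrict_EFin.
apply: (@le_trans _ _ (\int[mu]_x (b%:E * (u x)%:E))%E).
  apply: ge0_le_integral => //.
  - by move=> x _; exact: integral_ge0.
  - exact: measurable_fun_fubini_tonelli_F.
  - by apply: emeasurable_funM; [exact: measurable_cst|exact/measurable_EFinP].
  move=> x _; rewrite /fubini_F /h /=.
  under eq_integral do rewrite EFinM.
  rewrite ge0_integralZl_EFin//; [|by move=> y _; rewrite lee_fin|exact/measurable_EFinP].
  by rewrite muleC lee_wpmul2r// lee_fin.
rewrite ge0_integralZl_EFin//; [|by move=> y _; rewrite lee_fin|exact/measurable_EFinP].
by rewrite mulrC EFinM lee_wpmul2l// lee_fin.
Qed.

End KernelIntegral.

(** * Test functions and the inequality between the inverses *)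

Section Necessity.
Context {R : realType}.
Notation mu := (@lebesgue_measure R).

Lemma normcX (z : R[i]) n : normc (z ^+ n) = normc z ^+ n.
Proof.
elim: n => [|n IH]; first by rewrite !expr0 Normc.normc1.
by rewrite !exprS Normc.normcM IH.
Qed.

(** Two of the [M + 2] powers give integrability in [x], through [(|x| + c) ^ 2 <= 2 * (x ^ 2 + (y +
    c) ^ 2)]. The other [M >= alpha + 2] give the decay in [y], since the modulus is at least
    [y + c] and [c / (y + c) <= 1]. *)
Lemma kernel_decay (c alpha x y : R) M : 0 < c -> 0 < y ->
  alpha + 2 <= M%:R ->
  (c / normc (Complex x (y + c))) ^+ M.+2 <=
  2 * c ^+ 2 * (`|x| + c) `^ (- 2) *
    (c `^ (alpha + 2) * (y + c) `^ (- (alpha + 2))).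
Proof.
move=> c0 y0 aM; set rho := normc _.
have yc0 : 0 < y + c by rewrite addr_gt0.
have xc0 : 0 < `|x| + c by rewrite ltr_wpDl.
have rho_yc : y + c <= rho.
  by apply: le_trans (normc_Im (Complex x (y + c))); rewrite ler_norm.
have rho0 : 0 < rho by exact: lt_le_trans rho_yc.
have rho2 : rho ^+ 2 = x ^+ 2 + (y + c) ^+ 2.
  by rewrite /rho normc_Complex sqr_sqrtr// addr_ge0 ?sqr_ge0.
have cyc1 : c / (y + c) <= 1 by rewrite ler_pdivrMr// mul1r lerDr ltW.
have cyc0 : 0 < c / (y + c) by rewrite divr_gt0.
rewrite exprS exprS mulrA -expr2; apply: ler_pM.
- exact: sqr_ge0.
- by rewrite exprn_ge0// divr_ge0// ltW.
- rewrite expr_div_n (powR_invn 2 (ltW xc0)) ler_pdivrMr ?exprn_gt0//.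
  rewrite mulrAC ler_pdivlMr ?exprn_gt0// rho2.
  have h : (`|x| + c) ^+ 2 <= 2 * (x ^+ 2 + (y + c) ^+ 2).
    rewrite -(real_normK (num_real x)).
    have := sqr_ge0 (`|x| - c); have : c ^+ 2 <= (y + c) ^+ 2.
      by rewrite lerXn2r// ?nnegrE ?(ltW c0) ?(ltW yc0)// lerDr ltW.
    by rewrite !sqrrD sqrrN; lra.
  by have := ler_wpM2l (sqr_ge0 c) h; lra.
- have -> : c `^ (alpha + 2) * (y + c) `^ (- (alpha + 2)) =
      (c / (y + c)) `^ (alpha + 2).
    rewrite powRM ?(ltW c0) ?invr_ge0 ?(ltW yc0)//; congr (_ * _).
    by rewrite -(powR_inv1 (ltW yc0)) -powRrM mulN1r.
  apply: (@le_trans _ _ ((c / (y + c)) ^+ M)).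
    rewrite lerXn2r ?nnegrE ?divr_ge0 ?(ltW c0) ?(ltW rho0) ?(ltW yc0)//.
    by rewrite ler_pM2l// lef_pV2 ?posrE.
  by rewrite -powR_mulrn ?(ltW cyc0)//; apply: ger_powR => //; rewrite cyc0.
Qed.

Definition test_function (s c : R) n (w : R[i]) : R[i] :=
  (Complex (s * c ^+ n) 0) * (w - Complex 0 (- c))^-1 ^+ n.

Lemma holomorphic_test_function s c n : 0 < c ->
  holomorphic_on (@upper_half_plane R) (test_function s c n).
Proof.
move=> c0 w; rewrite /upper_half_plane/= => w0.
apply: (@derivable_kernelX R[i]); apply/eqP => wE; move: w0.
by rewrite wE/= ltrNr oppr0 ltNge ltW.
Qed.

Lemma normc_test_function s c n x y : 0 <= s -> 0 < c ->
  modc (test_function s c n (Complex x y)) =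
  s * (c / normc (Complex x (y + c))) ^+ n.
Proof.
move=> s0 c0; rewrite /modc /test_function Normc.normcM normcX Normc.normcV.
have -> : normc (Complex (s * c ^+ n) 0) = s * c ^+ n.
  rewrite normc_Complex expr0n addr0 sqrtr_sqr ger0_norm//.
  by rewrite mulr_ge0// exprn_ge0// ltW.
rewrite -mulrA -exprMn; congr (_ * (_ / normc _) ^+ _).
by congr Complex; rewrite /= ?subr0 ?opprK.
Qed.

(** The quotient [c / |w + i c|] is at most 1, so convexity takes its power out of [Phi], leaving
    [Phi s], which cancels [c ^ (alpha + 2)]. The integrals in [x] and [y] give [4 * c] and
    [1 / ((alpha + 1) * c)], so the bound is free of [c]. *)
Lemma test_function_modular Phi (alpha s c : R) M : growth_function Phi ->
  convex_on_nonneg Phi -> -1 < alpha -> alpha + 2 <= M%:R -> 0 < c -> 0 <= s ->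
  Phi s = c `^ (- (alpha + 2)) ->
  (orlicz_modular Phi alpha (test_function s c M.+2) 1 <= (4 / (alpha + 1))%:E)%E.
Proof.
move=> gP cP a1 aM c0 s0 Ps.
have a10 : 0 < alpha + 1 by rewrite -ltrBlDr sub0r.
have hf := @holomorphic_test_function s c M.+2 c0.
pose u (x : R) : R := 2 * c ^+ 2 * (`|x| + c) `^ (- 2).
have c20 : 0 <= 2 * c ^+ 2 by rewrite mulr_ge0// sqr_ge0.
have mu0 : measurable_fun setT (fun x : R => (`|x| + c) `^ (- 2)).
  apply: (@measurableT_comp _ _ _ _ _ _ (fun y : R => y `^ (- 2))).
    exact: measurable_powR.
  by apply: measurable_funD => //; exact: measurable_normr.
have mv0 := @measurable_halfline_kernel R alpha c.
have mu' : measurable_fun setT u by exact: measurable_funM.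
have u0 x : 0 <= u x by rewrite mulr_ge0// powR_ge0.
apply: (@le_trans _ _
  (\int[mu \x mu]_(p in @upper_half_plane_R2 R)
    (u p.1 * halfline_kernel alpha c p.2)%:E)%E).
  rewrite orlicz_modularE; apply: ge0_le_integral => //=.
  - exact: measurable_upper_half_plane.
  - by move=> p _; rewrite lee_fin modular_integrand_ge0.
  - by apply/measurable_EFinP; exact: measurable_modular_integrand.
  - apply/measurable_EFinP; apply: measurable_funTS; apply: measurable_funM.
      exact: (measurableT_comp mu' measurable_fst).
    exact: (measurableT_comp mv0 measurable_snd).
  move=> [x y] /= y0; rewrite lee_fin /modular_integrand/=.
  rewrite normc_test_function//; set tau := (c / _) ^+ _.
  have tau0 : 0 <= tau by rewrite exprn_ge0// divr_ge0 ?normc_ge0// ltW.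
  have tau1 : tau <= 1.
    have yc : c <= normc (Complex x (y + c)).
      apply: le_trans (normc_Im (Complex x (y + c))) => /=.
      by rewrite ger0_norm ?addr_ge0 ?ltW// ltrDr.
    apply: exprn_ile1; first by rewrite divr_ge0 ?normc_ge0// ltW.
    by rewrite ler_pdivrMr ?mul1r// (lt_le_trans c0).
  rewrite divr1 [s * tau]mulrC.
  apply: le_trans (ler_wpM2r (powR_ge0 _ _) (growth_scale gP cP tau0 tau1 s0)) _.
  rewrite Ps.
  apply: le_trans (ler_wpM2r (powR_ge0 _ _)
    (ler_wpM2r (powR_ge0 _ _) (kernel_decay x c0 y0 aM))) _.
  rewrite /u /halfline_kernel [c `^ (- _)]powRN le_eqVlt; apply/orP; left.
  by apply/eqP; field; rewrite gt_eqF// powR_gt0.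
apply: (@le_trans _ _ ((4 * c) * ((alpha + 1) * c)^-1)%:E).
  apply: integral_prod_le => //.
  - by move=> y; exact: halfline_kernel_ge0.
  - by rewrite invr_ge0 mulr_ge0// ltW.
  - have -> : 4 * c = 2 * c ^+ 2 * (2 * c^-1) by field; rewrite gt_eqF.
    under eq_integral do rewrite EFinM.
    rewrite ge0_integralZl_EFin//.
    + by rewrite [leRHS]EFinM lee_wpmul2l ?lee_fin// integral_even_kernel.
    + by move=> x _; rewrite lee_fin powR_ge0.
    + exact/measurable_EFinP.
  - exact: integral_halfline_kernel.
rewrite lee_fin le_eqVlt; apply/orP; left; apply/eqP.
by field; rewrite !gt_eqF.
Qed.

Lemma ginv_le_of_embedding (Phi1 Phi2 : R -> R) (alpha beta : R) :
  growth_function Phi1 -> convex_on_nonneg Phi1 ->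
  growth_function Phi2 -> convex_on_nonneg Phi2 -> class_U Phi2 ->
  -1 < alpha -> continuous_embedding Phi1 alpha Phi2 beta ->
  exists2 C : R, 0 < C & forall t : R, 0 < t ->
    ginv Phi1 (t `^ (2 + alpha)) <= ginv Phi2 (C * t `^ (2 + beta)).
Proof.
move=> g1 c1 g2 c2 u2 a1 [C' C'0 HE].
have [K K1 HK] := @pointwise_estimate R beta.
pose M := Num.bound (alpha + 2).
have aM : alpha + 2 <= M%:R.
  apply/ltW/archi_boundP; rewrite -lerBlDr sub0r ltW//.
  by apply: lt_trans a1; rewrite ltrN2 ltr1n.
pose k := Num.max 1 (4 / (alpha + 1)).
have k1 : 1 <= k by rewrite le_max lexx.
have k4 : 4 / (alpha + 1) <= k by rewrite le_max lexx orbT.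
have k0 : 0 < k by exact: lt_le_trans k1.
have K0 : 0 < K by exact: lt_le_trans K1.
(* The Luxemburg norm of each image is at most [C' * k]; adding 1 gives the strict inequality that
   [modular_lt_lux] needs. *)
pose lam := C' * k + 1.
have C'k0 : 0 < C' * k by exact: mulr_gt0.
have lam0 : 0 < lam by rewrite addr_gt0.
(* All losses in one dilation factor: [2 ^ (M + 2)] from the value of the test function at [i c],
   and [K * lam] from the pointwise estimate. It does not depend on [t], hence neither does [A]. *)
pose L := Num.max 1 (2 ^+ M.+2 * (K * lam)).
have L1 : 1 <= L by rewrite le_max lexx.
have LE : 2 ^+ M.+2 * (K * lam) <= L by rewrite le_max lexx orbT.
have [A A0 HA] := class_U_le g2 u2 L1.
exists A => // t t0.
pose c := t^-1; have c0 : 0 < c by rewrite invr_gt0.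
have ta0 : 0 < t `^ (2 + alpha) by exact: powR_gt0.
have Atb0 : 0 < A * t `^ (2 + beta) by rewrite mulr_gt0// powR_gt0.
have [s0 Ps _] := ginvE g1 c1 ta0; set s := ginv _ _ in s0 Ps *.
have cE g : c `^ g = t `^ (- g).
  by rewrite /c -(powR_inv1 (ltW t0)) -powRrM mulN1r.
have Psc : Phi1 s = c `^ (- (alpha + 2)) by rewrite cE opprK Ps addrC.
have Hk := test_function_modular g1 c1 a1 aM c0 s0 Psc.
set f := test_function s c M.+2 in Hk.
have hf : holomorphic_on (@upper_half_plane R) f by exact: holomorphic_test_function.
have Hf : in_bergman_orlicz Phi1 alpha f.
  by split => //; apply: le_lt_trans Hk _; rewrite ltry.
have [Hf2 Hlux] := HE f Hf.
have lux1 : lux_norm Phi1 alpha f <= k.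
  apply: lux_norm_le => //; rewrite -[k]mulr1.
  exact: modular_scale Hk.
have Hlam : (orlicz_modular Phi2 beta f lam <= 1)%E.
  apply: modular_lt_lux => //; first exact: lux_set_nonempty.
  apply: (@le_lt_trans _ _ (C' * k)); last by rewrite ltrDl.
  by apply: le_trans Hlux _; rewrite ler_wpM2l// ltW.
have := HK Phi2 f lam 0 c g2 c2 hf lam0 Hlam c0.
(* At [w = i c] the denominator [w + i c] is [2 i c], so each factor has modulus [1 / 2]. *)
have fc : modc (f (Complex 0 c)) = s / 2 ^+ M.+2.
  rewrite normc_test_function//.
  have -> : normc (Complex 0 (c + c)) = 2 * c.
    rewrite normc_Complex expr0n add0r sqrtr_sqr ger0_norm ?addr_ge0 ?(ltW c0)//.
    by rewrite mulr_natl mulr2n.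
  congr (_ * _); rewrite -exprVn; congr (_ ^+ _).
  by field; rewrite gt_eqF.
rewrite fc cE -ler_pdivlMr ?powR_gt0// div1r -powRN opprK.
have -> : s / 2 ^+ M.+2 / (K * lam) = s / (2 ^+ M.+2 * (K * lam)).
  by rewrite [in RHS]invfM mulrA.
move=> hs.
have [_ _ smax] := ginvE g2 c2 Atb0.
apply: smax => //; apply: le_trans (HA s s0) _.
rewrite ler_wpM2l ?(ltW A0)//; apply: le_trans hs.
have KL0 : 0 < 2 ^+ M.+2 * (K * lam).
  by apply: mulr_gt0; [rewrite exprn_gt0|exact: mulr_gt0].
apply: growth_le => //; first by rewrite divr_ge0// (le_trans ler01).
by rewrite ler_wpM2l// lef_pV2 ?posrE// (lt_le_trans KL0).
Qed.

End Necessity.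

Theorem theorem2p4 (R : realType) (Phi1 Phi2 : R -> R) (alpha beta : R) :
  growth_function Phi1 -> convex_on_nonneg Phi1 -> C1_on_nonneg Phi1 ->
  growth_function Phi2 -> convex_on_nonneg Phi2 -> C1_on_nonneg Phi2 ->
  class_U Phi2 ->
  -1 < alpha -> -1 < beta ->
  nabla2 Phi1 ->
  (forall s t : R, 0 < s -> s <= t -> Phi2 s / Phi1 s <= Phi2 t / Phi1 t) ->
  (continuous_embedding Phi1 alpha Phi2 beta <->
   exists2 C : R, 0 < C &
     forall t : R, 0 < t ->
       ginv Phi1 (t `^ (2 + alpha)) <= ginv Phi2 (C * t `^ (2 + beta))).
Proof.
move=> g1 c1 _ g2 c2 _ u2 a1 _ [d1 _] ratio; split.
  exact: ginv_le_of_embedding.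
by move=> [C C0 HC]; exact: embedding_of_ginv_le HC.
Qed.
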